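(* Let $\{v_1,\ldots,v_n\}$ be a basis of $\mathbb{R}^n$ and let $C=\mathbb{R}_{\geq 0}\cdot v_1+\cdots+\mathbb{R}_{\geq 0}\cdot v_n$ be the corresponding positive convex cone. Define the dual basis $\{v_1',\ldots,v_n'\}$ by $(v_i',v_j)=\delta_{ij}$ $(i,j=1,\ldots,n)$. Let $w$ be a (Borel) measurable weight on $\mathbb{R}^n$, quasi-analytic with respect to $\{v_1',\ldots,v_n'\}$. For $x=\sum_{j=1}^n x_j v_j\in C$ define $\phi(x)=\sum_{j=1}^n \sqrt{x_j}\,v_j$. Let $\mu$ be a positive Borel measure on $\mathbb{R}^n$ which is supported in $C$ and suppose that $$\int_C (w\circ\phi)(x)^{-1}\,d\mu(x)<\infty.$$ Then $\mu$ is $C$-determinate.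
   Context: $(\cdot,\cdot)$ is the standard inner product on $\mathbb{R}^n$ with norm $\Vert\cdot\Vert$. $\mathcal{M}^*$ is the set of all positive Borel measures $\mu$ on $\mathbb{R}^n$ such that $\int_{\mathbb{R}^n}\Vert x\Vert^d\,d\mu(x)<\infty$ for all $d\ge 0$. A measure $\mu$ supported in $C$ is $C$-determinate if $\mu\in\mathcal{M}^*$ and every $\nu\in\mathcal{M}^*$ which is also supported in $C$ and satisfies $\int_C P\,d\nu=\int_C P\,d\mu$ for all polynomials $P$ on $\mathbb{R}^n$ is equal to $\mu$. A weight on $\mathbb{R}^n$ is an arbitrary bounded function $w:\mathbb{R}^n\to\mathbb{R}_{\ge 0}$. Given a basis $\{u_1,\ldots,u_n\}$ of $\mathbb{R}^n$, the weight $w$ is quasi-analytic with respect to $\{u_1,\ldots,u_n\}$ if $$\sum_{m=1}^\infty \frac{1}{\Vert (u_j,x)^m w(x)\Vert_\infty^{1/m}}=\infty\qquad (j=1,\ldots,n),$$ where $\Vert\cdot\Vert_\infty$ is the supremum over all $x\in\mathbb{R}^n$ (with $1/0=+\infty$ and $1/\infty=0$). In $(w\circ\phi)^{-1}$, $1/0$ is read as $+\infty$. *)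

(* Defs.v *)
From HB Require Import structures.
From mathcomp Require Import all_boot all_order all_algebra.
From mathcomp Require Import all_classical all_reals all_analysis.
(* Not imported: the notations of mpoly clash with those of mathcomp-analysis. *)
From mathcomp Require mpoly.

Set Implicit Arguments.
Unset Strict Implicit.
Unset Printing Implicit Defensive.

Import Order.TTheory GRing.Theory Num.Theory.
Import numFieldNormedType.Exports.

Local Open Scope classical_set_scope.
Local Open Scope ring_scope.

(* R^n with its Borel sigma-algebra; as a type it is 'rV[R]_n. *)
Notation borel_rV R n := (g_sigma_algebraType (@open 'rV[R]_n)).

Section Euclidean.
Context {R : realType} {n : nat}.

Definition dotp (x y : 'rV[R]_n) : R := \sum_(i < n) x 0 i * y 0 i.

(* The norm `|x| that the library puts on 'rV[R]_n is the sup norm. *)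
Definition enorm (x : 'rV[R]_n) : R := Num.sqrt (dotp x x).

End Euclidean.

Section Determinacy.
Context {R : realType} {n : nat}.
Implicit Types (mu nu : {measure set (borel_rV R n) -> \bar R})
  (C : set 'rV[R]_n).

Definition finite_moments mu : Prop :=
  forall d : R, 0 <= d ->
    (\int[mu]_x ((enorm x) `^ d)%:E < +oo)%E.

(* For closed C this says that the support of mu is contained in C. *)
Definition supported_in mu C : Prop := mu (~` C) = 0%E.

Definition poly_fun (P : mpoly.mpoly n R) (x : 'rV[R]_n) : R :=
  mpoly.meval (fun i => x 0 i) P.

Definition determinate_on C mu : Prop :=
  [/\ supported_in mu C,
      finite_moments mu
    & forall nu, finite_moments nu -> supported_in nu C ->
        (forall P : mpoly.mpoly n R,
           (\int[nu]_(x in C) (poly_fun P x)%:E =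
            \int[mu]_(x in C) (poly_fun P x)%:E)%E) ->
        forall A : set (borel_rV R n), measurable A -> nu A = mu A].

End Determinacy.

Section QuasiAnalytic.
Context {R : realType} {n : nat}.
Implicit Type w : 'rV[R]_n -> R.

Definition weight w : Prop := (forall x, 0 <= w x) /\ bounded_fun w.

Definition sup_norm (f : 'rV[R]_n -> R) : \bar R :=
  ereal_sup [set (`|f x|)%:E | x in [set: 'rV[R]_n]].

(* The inverse of \bar R satisfies 0^-1 = +oo and +oo^-1 = 0. *)
Definition quasi_analytic w (u : n.-tuple 'rV[R]_n) : Prop :=
  forall j : 'I_n,
    (\sum_(1 <= m <oo)
        (sup_norm (fun x => dotp (tnth u j) x ^+ m * w x)%R
           `^ (m%:R^-1)%R)^-1 = +oo)%E.

End QuasiAnalytic.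

Section Cone.
Context {R : realType} {n : nat}.
Implicit Type v : n.-tuple 'rV[R]_n.

Definition pos_cone v : set 'rV[R]_n :=
  [set x | exists c : 'I_n -> R,
     (forall j, 0 <= c j) /\ x = \sum_(j < n) c j *: tnth v j].

(* Meaningful on pos_cone v for a basis v; elsewhere Num.sqrt sends the negative
   coordinates to 0. *)
Definition cone_sqrt v (x : 'rV[R]_n) : 'rV[R]_n :=
  \sum_(j < n) Num.sqrt (coord v j x) *: tnth v j.

End Cone.

(* Main.v *)
(* Write x = sum_j x_j v_j and s_j = sqrt x_j on C. The sup norms of
   (v'_j, x)^m w(x) are log-convex in m, so by Carleman's inequality their
   successive ratios have divergent sum, and they bound the moments
   int s_j^m dmu. If nu has the same moments as mu on C, monomials in the x_i are
   replaced one coordinate at a time by indicators of half-lines. For a fixed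
   coordinate with the other factors collected in g, put
   E f = int f(s_j) g dmu - int f(s_j) g dnu. The even function t |-> E (cos (t s))
   has all derivatives zero at 0 and its k-th derivative is O(M_k), hence it
   vanishes by Bang's elementary proof of the Denjoy-Carleman theorem. Then E kills
   polynomials in cos (t s), by bounded convergence the indicators of
   cos (t s) < cos (t b), and letting t tend to 0 those of s > b. So mu and nu
   agree on products of half-lines, which generate the Borel sets. *)
Require Import Defs.
From HB Require Import structures.
From mathcomp Require Import all_boot all_order all_algebra.
From mathcomp Require Import all_classical all_reals all_analysis.
From mathcomp Require Import measurable_realfun ring lra.
From mathcomp Require mpoly.

Set Implicit Arguments.
Unset Strict Implicit.
Unset Printing Implicit Defensive.

Import Order.TTheory GRing.Theory Num.Theory.
Import numFieldNormedType.Exports.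
Import (canonicals) mpoly.

Local Open Scope classical_set_scope.
Local Open Scope ring_scope.

(** * Bang's theorem and Carleman's inequality *)

Section RealAnalysis.
Context {R : realType}.
Implicit Types (a b c h t u x y : R).

(** Polynomials on the cone give only the even powers of s_j, since x_j = s_j^2. This is why the
    test function is cosine: its derivatives of odd order vanish at 0, so odd powers of s_j never
    have to be compared. Differentiation under the integral sign is avoided. Bang's argument is run
    on a family [c j] linked only by one-sided Taylor estimates with remainder
    [M (j + m) * (h ^+ m / m!)], and E inherits these from the pointwise estimates for cosine. The
    collected factor g mixes indicators and monomials and enters only through the integral of g^2.
    The order of the derivative therefore shows up in the bounds through M alone: a bound K M_n^2 on
    the moment of s^(2n) gives O(M_n) for E(s^n f) with f bounded, with a constant that does not
    depend on n. The integral condition concerns mu only. It reaches nu because the moments it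
    controls are polynomial ones, which nu shares. *)

Lemma nondecreasing_of_derive (f f' : R -> R) b :
  (forall x, is_derive x 1 f (f' x)) -> (forall x, 0 <= x -> 0 <= f' x) ->
  0 <= b -> f 0 <= f b.
Proof.
move=> df f'0 b0.
have cf x : {for x, continuous f}.
  by apply: differentiable_continuous; apply/derivable1_diffP; exact: (@ex_derive _ _ _ _ _ _ _ (df x)).
apply: (@ger0_derive1_ndecr R f 0 b) => //.
- move=> x; rewrite in_itv /= => /andP[x0 _].
  by have dfx := df x; rewrite derive1E derive_val f'0// ltW.
- by apply: continuous_subspaceT => x; exact: cf.
Qed.

(** The derivative of order [k] of cosine. Shifting the argument turns differentiation into a shift
    of the index and spares a case split on [k] modulo 4. *)
Definition cosd (k : nat) u := cos (u + k%:R * (pi / 2)).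

Lemma is_derive_cosd k u : is_derive u 1 (cosd k) (cosd k.+1 u).
Proof.
have -> : cosd k.+1 u = - sin (u + k%:R * (pi / 2)).
  by rewrite /cosd -natr1 mulrDl mul1r addrA cosDpihalf.
have /is_derive_eq : is_derive u 1 (cos \o (fun u => u + k%:R * (pi / 2)))
    (- sin (u + k%:R * (pi / 2)) * (1 + 0)) by exact: is_derive1_comp.
by apply; rewrite addr0 mulr1.
Qed.

Lemma is_derive_expn_div n c x :
  is_derive x 1 (fun y => c * y ^+ n.+1 / (n.+1)`!%:R) (c * x ^+ n / n`!%:R).
Proof.
have d : is_derive x 1 (fun y : R => y ^+ n.+1) (n.+1%:R * x ^+ n).
  apply: DeriveDef; first exact: exprn_derivable.
  by rewrite exp_derive /GRing.scale/= mulr1.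
rewrite (_ : (fun _ => _) = (c / (n.+1)`!%:R) \*: (fun y : R => y ^+ n.+1)); last first.
  by apply/funext => y; rewrite mulrAC.
apply: is_derive_eq; rewrite /GRing.scale/= factS natrM.
have n0 : n.+1%:R != 0 :> R by rewrite pnatr_eq0.
by rewrite invfM -[RHS]mulr1 -[X in _ = _ * X](mulfV n0); ring.
Qed.

Lemma is_derive_exp_sum (c : nat -> R) m x :
  is_derive x 1 (fun x => \sum_(i < m.+1) c i * x ^+ i / i`!%:R)
    (\sum_(i < m) c i.+1 * x ^+ i / i`!%:R).
Proof.
elim: m => [|m IHm].
  rewrite big_ord0 (_ : (fun _ => _) = cst (c 0%N)); first exact: is_derive_cst.
  by apply/funext => y; rewrite big_ord1/= expr0 fact0 divr1 mulr1.
rewrite (_ : (fun _ => _) = (fun x => \sum_(i < m.+1) c i * x ^+ i / i`!%:R)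
    \+ (fun x => c m.+1 * x ^+ m.+1 / (m.+1)`!%:R)); last first.
  by apply/funext => y; rewrite big_ord_recr.
rewrite big_ord_recr/=; apply: is_deriveD => //.
exact: is_derive_expn_div.
Qed.

(** The remainder of order [m.+1] has as derivative the remainder of order [m] for the next
    derivative of cosine. By induction [p + r] and [p - r] are both nondecreasing, and they start at
    0. *)
Lemma cosd_taylor k m a b : 0 <= b ->
  `|cosd k (a + b) - \sum_(i < m) cosd (k + i) a * b ^+ i / i`!%:R|
  <= b ^+ m / m`!%:R.
Proof.
elim: m k b => [|m IHm] k b b0.
  by rewrite big_ord0 subr0 expr0 fact0 divr1 ler_norml cos_geN1 cos_le1.
pose p x := x ^+ m.+1 / (m.+1)`!%:R : R.
pose p' x := x ^+ m / m`!%:R : R.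
pose r x := cosd k (a + x) - \sum_(i < m.+1) cosd (k + i) a * x ^+ i / i`!%:R.
pose r' x := cosd k.+1 (a + x) - \sum_(i < m) cosd (k.+1 + i) a * x ^+ i / i`!%:R.
have dp x : is_derive x 1 p (p' x).
  have := is_derive_expn_div m 1 x; rewrite mul1r -/(p' x).
  by rewrite (_ : (fun _ => _) = p)//; apply/funext => y; rewrite mul1r.
have dr x : is_derive x 1 r (r' x).
  rewrite /r /r'; apply: is_deriveB; last first.
    under eq_bigr do rewrite addSnnS.
    exact: (is_derive_exp_sum (fun i => cosd (k + i) a)).
  have dcos := is_derive_cosd k (a + x).
  have /is_derive_eq : is_derive x 1 (cosd k \o (fun x => a + x))
    (cosd k.+1 (a + x) * (0 + 1)) by exact: is_derive1_comp.
  by apply; rewrite add0r mulr1.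
have r0 : r 0 = 0.
  rewrite /r addr0 big_ord_recl/= addn0 expr0 fact0 divr1 mulr1.
  rewrite big1 ?addr0 ?subrr// => i _.
  by rewrite expr0n/= mulr0 mul0r.
have p0 : p 0 = 0 by rewrite /p expr0n/= mul0r.
have rp x : 0 <= x -> `|r' x| <= p' x by exact: IHm.
rewrite -/(r b) -/(p b) ler_norml; apply/andP; split.
- have : (p \+ r) 0 <= (p \+ r) b; last by rewrite /= r0 p0 addr0 -lerBlDl sub0r.
  apply: (nondecreasing_of_derive (f' := fun x => p' x + r' x)) => // x x0.
  by have := rp _ x0; rewrite ler_norml => /andP[]; rewrite -subr_ge0 opprK addrC.
- have : (p \- r) 0 <= (p \- r) b; last by rewrite /= r0 p0 subr0 subr_ge0.
  apply: (nondecreasing_of_derive (f' := fun x => p' x - r' x)) => // x x0.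
  by have := rp _ x0; rewrite ler_norml subr_ge0 => /andP[].
Qed.

Section Bang.
Variables (M : nat -> R) (c : nat -> R -> R).
Hypothesis M_gt0 : forall n, 0 < M n.
Hypothesis M_logconvex : forall n, M n.+1 ^+ 2 <= M n * M n.+2.
Hypothesis c_taylor : forall j m x h, 0 <= x -> 0 <= h ->
  `|c j (x + h) - \sum_(i < m) c (j + i) x * h ^+ i / i`!%:R|
  <= M (j + m) * (h ^+ m / m`!%:R).

Let mu N := M N.+1 / M N.

Let mu_gt0 N : 0 < mu N. Proof. by rewrite divr_gt0. Qed.

Let mu_ndecr i N : (i <= N)%N -> mu i <= mu N.
Proof.
move: i N; apply: (homo_leq (@lexx _ R) (@le_trans _ R)) => n.
by rewrite /mu ler_pdivrMr// mulrAC ler_pdivlMr// -expr2 mulrC.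
Qed.

(** [M (j + i) / M j] is a product of [i] ratios of index at most [N], and log-convexity makes the
    ratios nondecreasing. *)
Let M_le j i N : (j + i <= N.+1)%N -> M (j + i) <= M j * mu N ^+ i.
Proof.
elim: i => [|i IHi] ji; first by rewrite addn0 expr0 mulr1.
rewrite addnS in ji; have := IHi (ltnW ji) => /(ler_wpM2r (ltW (mu_gt0 (j + i)))).
rewrite {1}/mu mulrCA mulfV ?gt_eqF// mulr1 addnS => /le_trans; apply.
rewrite exprSr mulrA ler_wpM2l//; first by rewrite mulr_ge0 ?exprn_ge0// ltW.
exact: mu_ndecr.
Qed.

(* The invariant of Bang's proof: moving to the right by M_N / (4 M_{N+1})
   costs at most one derivative and one factor of 2. *)
Let small N x := forall j, (j < N)%N -> `|c j x| <= M j * (2 ^+ j / 2 ^+ N).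

Let half_sum n y : 0 <= y -> y <= 2^-1 -> \sum_(i < n) y ^+ i <= 2.
Proof.
move=> y0 y1; suff : \sum_(i < n) y ^+ i <= 2 - 2 * 2^-1 ^+ n.
  move=> /le_trans; apply; rewrite gerBl mulr_ge0// exprn_ge0//.
elim: n => [|n IHn]; first by rewrite big_ord0 expr0 mulr1 subrr.
rewrite big_ord_recr/=; apply: (le_trans (lerD IHn (lerXn2r n _ _ y1))); rewrite ?nnegrE//.
by rewrite exprS; lra.
Qed.

Let small_step N x h : 0 <= x -> 0 <= h -> h <= M N / M N.+1 / 4 ->
  small N.+1 x -> small N (x + h).
Proof.
move=> x0 h0 hN sx j jN.
(* The 4 in the step length is spent here: one factor 2 pays for the growth of [2 ^+ (j + i)] with
   [i], the other brings the ratio of the geometric series down to 1/2. *)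
have hmu : 2 * (mu N * h) <= 2^-1.
  have : mu N * h <= mu N * (M N / M N.+1 / 4) by rewrite ler_pM2l.
  rewrite /mu mulrA mulrA divfK ?gt_eqF// mulfV ?gt_eqF//; lra.
have hmu0 : 0 <= 2 * (mu N * h) by rewrite mulr_ge0// mulr_ge0// ltW.
(* With this order the Taylor remainder involves [M N.+1], where the weight [2 ^+ N.+1 / 2 ^+ N.+1]
   is 1. It then has the form of the term [i = m], and terms and remainder together are bounded by
   one geometric series of sum at most 2. *)
set m := (N.+1 - j)%N.
have jm : (j + m = N.+1)%N by rewrite /m subnKC// ltnW// ltnW.
have fac_le i : h ^+ i / i`!%:R <= h ^+ i.
  rewrite ler_piMr ?exprn_ge0// invf_le1 ?ltr0n ?fact_gt0//.
  by rewrite ler1n fact_gt0.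
have fac_ge i : 0 <= h ^+ i / i`!%:R by rewrite divr_ge0 ?exprn_ge0.
have pos2 k : 0 < 2 ^+ k :> R by rewrite exprn_gt0.
have term i z : (j + i <= N.+1)%N -> 0 <= z -> z <= M (j + i) * (2 ^+ (j + i) / 2 ^+ N.+1) ->
    z * (h ^+ i / i`!%:R) <= M j * (2 ^+ j / 2 ^+ N.+1) * (2 * (mu N * h)) ^+ i.
  move=> ji z0 zle; apply: (le_trans (ler_pM z0 (fac_ge i) zle (fac_le i))).
  have le1 : M (j + i)%N * (2 ^+ (j + i) / 2 ^+ N.+1) * h ^+ i <=
      M j * mu N ^+ i * (2 ^+ (j + i) / 2 ^+ N.+1) * h ^+ i.
    by rewrite ler_wpM2r ?exprn_ge0// ler_wpM2r ?M_le// divr_ge0 ?ltW.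
  apply: (le_trans le1).
  by rewrite exprD !exprMn le_eqVlt; apply/orP; left; apply/eqP; ring.
have -> : M j * (2 ^+ j / 2 ^+ N) = M j * (2 ^+ j / 2 ^+ N.+1) * 2.
  by rewrite exprS; field; rewrite expf_neq0.
have Mj : 0 <= M j * (2 ^+ j / 2 ^+ N.+1) by rewrite mulr_ge0 ?divr_ge0 ?ltW.
apply: le_trans (ler_wpM2l Mj (@half_sum m.+1 _ hmu0 hmu)).
rewrite -[c j (x + h)](subrK (\sum_(i < m) c (j + i)%N x * h ^+ i / i`!%:R)).
rewrite addrC (le_trans (ler_normD _ _))// mulr_sumr big_ord_recr/= lerD//.
- rewrite (le_trans (ler_norm_sum _ _ _))// ler_sum// => i _.
  rewrite -mulrA normrM (ger0_norm (fac_ge i)); apply: term => //.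
    by rewrite -jm leq_add2l ltnW.
  by apply: sx; rewrite -jm ltn_add2l.
- apply: (le_trans (c_taylor j m x0 h0)); apply: term; rewrite jm//; first exact: ltW.
  by rewrite divff ?mulr1 ?gt_eqF.
Qed.

Hypothesis M_div : forall B, exists N, B <= \sum_(n < N) M n / M n.+1.
Hypothesis c_0 : forall j, c j 0 = 0.

Lemma bang x : 0 <= x -> c 0 x = 0.
Proof.
move=> x0.
have small0 N : small N 0.
  by move=> j _; rewrite c_0 normr0 mulr_ge0 ?divr_ge0 ?exprn_ge0// ltW.
(* At 0 the invariant holds at every level. Each step to the right descends one level, so level [k]
   is still available at the distance covered by the steps of levels [k] to [k + d - 1]. *)
have smalls d k y : 0 <= y -> y <= \sum_(i < d) M (k + i) / M (k + i).+1 / 4 ->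
    small k y.
  elim: d k y => [|d IHd] k y y0.
    by rewrite big_ord0 => yle; have -> : y = 0 by apply/le_anti/andP.
  rewrite big_ord_recl/= addn0 => yle.
  have [yh|hy] := leP y (M k / M k.+1 / 4).
    by rewrite -[y]add0r; apply: small_step.
  rewrite -(subrK (M k / M k.+1 / 4) y); apply: small_step => //.
  - by rewrite subr_ge0 ltW.
  - by rewrite ?divr_ge0// ltW.
  - apply: IHd; first by rewrite subr_ge0 ltW.
    rewrite lerBlDl (le_trans yle)// lerD2l le_eqVlt; apply/orP; left; apply/eqP.
    by apply: eq_bigr => i _; rewrite /bump/= add1n addnS addSn.
(* Dropping the first [k.+1] ratios leaves a divergent series, so [x] can be reached from 0 without
   descending below level [k.+1], however large [k] is. *)
have bound k : `|c 0 x| <= M 0 / 2 ^+ k.+1.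
  have [N] := M_div (\sum_(n < k.+1) M n / M n.+1 + 4 * x) => BN.
  have : small k.+1 x.
    apply: (smalls N) => //.
    have : \sum_(n < N) M n / M n.+1 <= \sum_(n < k.+1 + N) M n / M n.+1.
      rewrite addnC big_split_ord/= lerDl sumr_ge0// => i _.
      by rewrite divr_ge0 ?ltW.
    move=> /(le_trans BN); rewrite big_split_ord/= lerD2l -mulr_suml; lra.
  by move=> /(_ 0%N isT); rewrite expr0 mul1r.
apply/eqP; rewrite -normr_le0; apply/ler_addgt0Pl => e e0; rewrite addr0.
have [k Hk] : exists k, M 0 / 2 ^+ k.+1 <= e.
  exists (Num.bound (M 0 / e)).
  have := archi_boundP (divr_ge0 (ltW (M_gt0 0)) (ltW e0)).
  set k := Num.bound _ => Hk.
  rewrite ler_pdivrMr ?exprn_gt0// mulrC -ler_pdivrMr// (le_trans (ltW Hk))//.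
  by rewrite -natrX ler_nat (leq_trans (leqnSn _))// ltnW// ltn_expl.
exact: le_trans (bound k) Hk.
Qed.

End Bang.

(* The weights are those for which the product
   w_0 ... w_n is (n + 2) ^ (n + 1), so that AM-GM telescopes. *)
Lemma carleman_ineq (a G : nat -> R) N :
  (forall n, 0 <= a n) -> (forall n, 0 <= G n) ->
  (forall n, G n ^+ n.+1 <= \prod_(j < n.+1) a j) ->
  \sum_(n < N) G n <= expR 1 * \sum_(n < N) a n.
Proof.
move=> a0 G0 Ga.
pose w (j : nat) : R := j.+2%:R ^+ j.+1 / j.+1%:R ^+ j.
have w0 j : 0 < w j by rewrite divr_gt0// exprn_gt0.
have prodw n : \prod_(j < n.+1) w j = n.+2%:R ^+ n.+1.
  elim: n => [|n IHn]; first by rewrite big_ord1 /w expr0 divr1.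
  have n0 : n.+2%:R ^+ n.+1 != 0 :> R by rewrite expf_neq0// pnatr_eq0.
  by rewrite big_ord_recr/= IHn /w mulrC divfK.
have Gle n : G n <= (\sum_(j < n.+1) w j * a j) * (n.+1%:R^-1 - n.+2%:R^-1).
  have S0 : 0 <= \sum_(j < n.+1) w j * a j.
    by apply: sumr_ge0 => j _; rewrite mulr_ge0// ltW.
  have agm : n.+2%:R ^+ n.+1 * \prod_(j < n.+1) a j <= 
      ((\sum_(j < n.+1) w j * a j) / n.+1%:R) ^+ n.+1.
    have := @leif_AGM R 'I_n.+1 predT (fun j => w j * a j).
    rewrite cardT size_enum_ord big_split/= prodw => H; apply: H.
    by move=> j _; rewrite mulr_ge0// ltW.
  have : (n.+2%:R * G n) ^+ n.+1 <= n.+2%:R ^+ n.+1 * \prod_(j < n.+1) a j.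
    by rewrite exprMn ler_pM2l ?exprn_gt0.
  move=> /le_trans/(_ agm).
  rewrite ler_pXn2r ?nnegrE ?mulr_ge0 ?divr_ge0//.
  rewrite mulrC -ler_pdivlMr// => /le_trans; apply.
  have n1 : n.+1%:R != 0 :> R by rewrite pnatr_eq0.
  have n2 : n.+2%:R != 0 :> R by rewrite pnatr_eq0.
  have -> : n.+1%:R^-1 - n.+2%:R^-1 = n.+1%:R^-1 / n.+2%:R :> R.
    by apply: (mulfI n1); apply: (mulIf n2); rewrite -[n.+2%:R]natr1; field; apply/andP.
  by rewrite mulrA.
have Gsum : \sum_(n < N) G n <= \sum_(j < N) w j * a j * (j.+1%:R^-1 - N.+1%:R^-1).
  elim: N => [|N IHN]; first by rewrite !big_ord0.
  rewrite big_ord_recr/= (le_trans (lerD IHN (Gle N)))//.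
  rewrite !big_ord_recr/= mulrDl addrA lerD2r mulr_suml -big_split/=.
  by apply: ler_sum => j _; rewrite -mulrDr addrA subrK.
apply: (le_trans Gsum); rewrite mulr_sumr; apply: ler_sum => j _.
rewrite (@le_trans _ _ (w j * a j * j.+1%:R^-1))//.
  by rewrite ler_wpM2l ?gerBl ?invr_ge0// mulr_ge0// ltW.
rewrite mulrAC ler_wpM2r//.
(* This is where the constant e of Carleman's inequality comes from. *)
have -> : w j / j.+1%:R = (1 + j.+1%:R^-1) ^+ j.+1.
  have j1 : j.+1%:R != 0 :> R by rewrite pnatr_eq0.
  have -> : 1 + j.+1%:R^-1 = j.+2%:R / j.+1%:R :> R.
    by rewrite -[j.+2%:R]natr1 mulrDl mulfV// mul1r.
  by rewrite /w expr_div_n -mulrA -invfM -exprSr.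
rewrite (le_trans (lerXn2r _ _ _ (expR_ge1Dx j.+1%:R^-1)))// ?nnegrE ?expR_ge0 ?addr_ge0//.
by rewrite -expRM_natl mulfV.
Qed.

End RealAnalysis.

(** * One coordinate *)

Section Threshold.
Context {R : realType}.
Implicit Types (y z r th : R).

Lemma bernoulli_lower z k : 0 <= z -> z <= 1 -> 1 - k%:R * z <= (1 - z) ^+ k.
Proof.
move=> z0 z1; elim: k => [|k IHk]; first by rewrite mul0r subr0 expr0.
have z1' : 0 <= 1 - z by rewrite subr_ge0.
rewrite exprSr (le_trans _ (ler_wpM2r z1' IHk))//.
have : 0 <= k%:R * z * z :> R by rewrite !mulr_ge0.
by rewrite -natr1; lra.
Qed.

Lemma bernoulli_upper z k : 0 <= z -> z <= 1 -> (1 - z) ^+ k * (1 + k%:R * z) <= 1.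
Proof.
move=> z0 z1; elim: k => [|k IHk]; first by rewrite mul0r addr0 expr0 mulr1.
have z1' : 0 <= 1 - z by rewrite subr_ge0.
apply: le_trans IHk; rewrite exprSr -mulrA ler_wpM2l ?exprn_ge0//.
have : 0 <= k%:R * z * z :> R by rewrite !mulr_ge0.
have : 0 <= z * z by rewrite mulr_ge0.
by rewrite -natr1; lra.
Qed.

(** With [r = q ^+ 2], the product [n * q ^+ n] is bounded, because [q ^+ n] is at most each of the
    [n] terms of a convergent geometric series. One more factor [q ^+ n] remains and tends to 0. *)
Lemma cvg_natM_expr r : 0 <= r -> r < 1 ->
  (fun n => n%:R * r ^+ n) @ \oo --> (0 : R).
Proof.
move=> r0 r1; pose q := Num.sqrt r.
have q0 : 0 <= q := sqrtr_ge0 r.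
have q1 : q < 1 by rewrite -sqrtr1 ltr_sqrt.
have nq n : n%:R * q ^+ n * (1 - q) <= 1.
  have -> : n%:R * q ^+ n = \sum_(i < n) q ^+ n.
    by rewrite sumr_const card_ord mulr_natl.
  have : \sum_(i < n) q ^+ n <= \sum_(i < n) q ^+ i.
    by apply: ler_sum => i _; rewrite ler_wiXn2l ?(ltW q1)// ltnW.
  have q1' : 0 <= 1 - q by rewrite subr_ge0 ltW.
  move=> /(ler_wpM2r q1') /le_trans; apply.
  by rewrite mulrC -[leLHS]opprK -mulNr opprB -subrX1 opprB gerBl exprn_ge0.
have cq : (fun n => (1 - q)^-1 * q ^+ n) @ \oo --> (0 : R).
  rewrite -(mulr0 (1 - q)^-1); apply: cvgMr; apply: cvg_expr.
  by rewrite ger0_norm.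
apply: (squeeze_cvgr (f := cst 0) _ _ cq); last exact: cvg_cst.
apply: nearW => n; rewrite mulr_ge0 ?exprn_ge0//=.
rewrite -[r](sqr_sqrtr r0) -/q -exprM mulnC exprM expr2 mulrA ler_wpM2r ?exprn_ge0//.
by rewrite -[leRHS]mul1r ler_pdivlMr ?subr_gt0// -exprnM ?expr1n.
Qed.

(* The numerator n + 1 in the exponent makes the limit at y = th equal to 0; with
   numerator 1 it would be 1 / e for th < 1. *)
Lemma cvg_threshold y th : 0 <= y -> y <= 1 -> 0 < th -> th <= 1 ->
  (fun n => (1 - y ^+ n.+1) ^+ Num.trunc (n.+1%:R / th ^+ n.+1)) @ \oo
    --> ((y < th)%R%:R : R).
Proof.
move=> y0 y1 th0 th1; set k := fun n => Num.trunc (n.+1%:R / th ^+ n.+1).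
have z0 n : 0 <= y ^+ n.+1 by rewrite exprn_ge0.
have z1 n : y ^+ n.+1 <= 1 by rewrite exprn_ile1.
have thn n : 0 < th ^+ n.+1 by rewrite exprn_gt0.
have q0 n : 0 <= n.+1%:R / th ^+ n.+1 by rewrite divr_ge0// ltW.
have p0 n : 0 <= (1 - y ^+ n.+1) ^+ k n by rewrite exprn_ge0// subr_ge0.
have [yth|thy] := ltP y th => /=.
- have r0 : 0 <= y / th by rewrite divr_ge0// ltW.
  have r1 : y / th < 1 by rewrite ltr_pdivrMr// mul1r.
  have c1 : (fun n => 1 - n.+1%:R * (y / th) ^+ n.+1) @ \oo --> (1 : R).
    rewrite -[X in _ --> X]subr0; apply: cvgB; first exact: cvg_cst.
    by have := cvg_natM_expr r0 r1; rewrite -(cvg_shiftS (fun n => _)).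
  apply: (squeeze_cvgr (h := cst 1) _ c1); last exact: cvg_cst.
  apply: nearW => n; apply/andP; split; last first.
    by rewrite exprn_ile1 ?subr_ge0// gerBl.
  apply: le_trans (bernoulli_lower (k n) (z0 n) (z1 n)).
  rewrite lerD2l lerN2 expr_div_n mulrA mulrAC ler_wpM2r//.
  by have /andP[] := truncn_itv (q0 n).
(* Truncation loses at most [th ^+ n.+1 <= 1], so [k n * y ^+ n.+1] exceeds [n], and Bernoulli's
   inequality bounds the power by 1 / (n + 1). This covers [y = th] as well. *)
- apply: (squeeze_cvgr (f := cst 0) _ _ (@cvg_harmonic R)); last exact: cvg_cst.
  apply: nearW => n; rewrite p0/= /harmonic.
  rewrite -[leRHS]mul1r ler_pdivlMr//.
  apply: le_trans (bernoulli_upper (k n) (z0 n) (z1 n)).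
  rewrite ler_wpM2l//.
  have /andP[_] := truncn_itv (q0 n); rewrite -/(k n) ltr_pdivrMr// => kn.
  have : th ^+ n.+1 <= y ^+ n.+1 by rewrite lerXn2r ?nnegrE// ltW.
  move=> /(ler_wpM2l (ler0n R (k n))).
  have : th ^+ n.+1 <= 1 by rewrite exprn_ile1// ltW.
  by move: kn; rewrite -[(k n).+1%:R]natr1 mulrDl mul1r; lra.
Qed.

End Threshold.

(** * Comparing two measures on functions of one coordinate *)

Section MomentGap.
Context d (T : measurableType d) (R : realType).
Variables (mu nu : {measure set T -> \bar R}) (s g : T -> R).
Implicit Types f h : R -> R.

(** Real-valued integrals take a default value when the integral is infinite, so linearity of [gap]
    requires integrability against both measures. *)
Definition admissible f : Prop :=
  [/\ measurable_fun [set: R] f,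
      mu.-integrable [set: T] (fun x => (f (s x) * g x)%:E)
    & nu.-integrable [set: T] (fun x => (f (s x) * g x)%:E)].

Definition gap f : R :=
  \int[mu]_x (f (s x) * g x) - \int[nu]_x (f (s x) * g x).

Lemma admissibleD f h : admissible f -> admissible h ->
  admissible (fun y => f y + h y).
Proof.
move=> [mf f1 f2] [mh h1 h2]; split; first exact: measurable_funD.
- rewrite (_ : (fun _ => _) = (fun x => (f (s x) * g x)%:E) \+
      (fun x => (h (s x) * g x)%:E))%E; first exact: integrableD.
  by apply/funext => x /=; rewrite mulrDl EFinD.
- rewrite (_ : (fun _ => _) = (fun x => (f (s x) * g x)%:E) \+
      (fun x => (h (s x) * g x)%:E))%E; first exact: integrableD.
  by apply/funext => x /=; rewrite mulrDl EFinD.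
Qed.

Lemma admissibleZ a f : admissible f -> admissible (fun y => a * f y).
Proof.
move=> [mf f1 f2]; split; first exact: measurable_funM.
- rewrite (_ : (fun _ => _) = fun x => (a%:E * (f (s x) * g x)%:E)%E).
    exact: integrableZl.
  by apply/funext => x /=; rewrite -EFinM mulrA.
- rewrite (_ : (fun _ => _) = fun x => (a%:E * (f (s x) * g x)%:E)%E).
    exact: integrableZl.
  by apply/funext => x /=; rewrite -EFinM mulrA.
Qed.

Lemma gapD f h : admissible f -> admissible h ->
  gap (fun y => f y + h y) = gap f + gap h.
Proof.
move=> [mf f1 f2] [mh h1 h2]; rewrite /gap.
under eq_Rintegral do rewrite mulrDl.
under [X in _ - X = _]eq_Rintegral do rewrite mulrDl.
by rewrite !RintegralD//; lra.
Qed.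

Lemma gapZ a f : admissible f -> gap (fun y => a * f y) = a * gap f.
Proof.
move=> [mf f1 f2]; rewrite /gap.
under eq_Rintegral do rewrite -mulrA.
under [X in _ - X = _]eq_Rintegral do rewrite -mulrA.
by rewrite !RintegralZl// mulrBr.
Qed.

Lemma admissible0 : admissible (cst 0).
Proof.
split; first exact: measurable_cst.
- rewrite (_ : (fun _ => _) = cst 0%E); first exact: integrable0.
  by apply/funext => x /=; rewrite mul0r.
- rewrite (_ : (fun _ => _) = cst 0%E); first exact: integrable0.
  by apply/funext => x /=; rewrite mul0r.
Qed.

Lemma gap0 : gap (cst 0) = 0.
Proof.
rewrite /gap; under eq_Rintegral do rewrite mul0r.
under [X in _ - X = _]eq_Rintegral do rewrite mul0r.
by rewrite !Rintegral_cst// !mul0r subrr.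
Qed.

Lemma gap_sum n (F : nat -> R -> R) :
  (forall i, (i < n)%N -> admissible (F i)) ->
  admissible (fun y => \sum_(i < n) F i y) /\
  gap (fun y => \sum_(i < n) F i y) = \sum_(i < n) gap (F i).
Proof.
elim: n => [|n IHn] aF.
  rewrite (_ : (fun _ => _) = cst 0); last by apply/funext => y; rewrite big_ord0.
  by rewrite big_ord0 gap0; split => //; exact: admissible0.
have [aS gS] := IHn (fun i ni => aF i (ltnW ni)).
rewrite (_ : (fun _ => _) = (fun y => \sum_(i < n) F i y + F n y)); last first.
  by apply/funext => y; rewrite big_ord_recr.
split; first by apply: admissibleD => //; exact: aF.
by rewrite gapD ?gS ?big_ord_recr//; exact: aF.
Qed.

Section Carleman.
Variables (M : nat -> R) (K : R).
Hypothesis ms : measurable_fun [set: T] s.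
Hypothesis mg : measurable_fun [set: T] g.
Hypothesis s_ge0 : forall x, 0 <= s x.
Hypothesis M_gt0 : forall n, 0 < M n.
Hypothesis M_logconvex : forall n, M n.+1 ^+ 2 <= M n * M n.+2.
Hypothesis M_div : forall B, exists N, B <= \sum_(n < N) M n / M n.+1.
Hypothesis mu_moment : forall n,
  (\int[mu]_x (s x ^+ n.*2)%:E <= (K * M n ^+ 2)%:E)%E.
Hypothesis nu_moment : forall n,
  (\int[nu]_x (s x ^+ n.*2)%:E <= (K * M n ^+ 2)%:E)%E.
Hypothesis mu_sq : mu.-integrable [set: T] (fun x => (g x ^+ 2)%:E).
Hypothesis nu_sq : nu.-integrable [set: T] (fun x => (g x ^+ 2)%:E).
Hypothesis moments_eq : forall n, gap (fun y => y ^+ n.*2) = 0.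

(* Instead of Cauchy-Schwarz: s^n |g| <= s^(2n) / M_n + M_n g^2. *)
Let Rintegral_bound (m : {measure set T -> \bar R}) f a n :
  (\int[m]_x (s x ^+ n.*2)%:E <= (K * M n ^+ 2)%:E)%E ->
  m.-integrable [set: T] (fun x => (g x ^+ 2)%:E) ->
  measurable_fun [set: R] f -> 0 <= a ->
  (forall y, 0 <= y -> `|f y| <= a * y ^+ n) ->
  m.-integrable [set: T] (fun x => (f (s x) * g x)%:E) /\
  `|\int[m]_x (f (s x) * g x)| <= a * ((K + \int[m]_x (g x ^+ 2)) * M n).
Proof.
move=> mom sq mf a0 fa.
have mfs : measurable_fun [set: T] (fun x => f (s x)) by exact: measurableT_comp.
have mfg : measurable_fun [set: T] (fun x => f (s x) * g x).
  exact: measurable_funM.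
have si : m.-integrable [set: T] (fun x => (s x ^+ n.*2)%:E).
  apply/integrableP; split.
    by apply/measurable_EFinP; exact: measurable_funX.
  under eq_integral do rewrite gee0_abs ?lee_fin ?exprn_ge0//.
  exact: le_lt_trans mom (ltry _).
pose b x := a * ((M n)^-1 * s x ^+ n.*2 + M n * g x ^+ 2).
have b1 : m.-integrable [set: T] (fun x => ((M n)^-1 * s x ^+ n.*2)%:E).
  by under eq_fun do rewrite EFinM; exact: integrableZl.
have b2 : m.-integrable [set: T] (fun x => (M n * g x ^+ 2)%:E).
  by under eq_fun do rewrite EFinM; exact: integrableZl.
have b12 : m.-integrable [set: T]
    (fun x => ((M n)^-1 * s x ^+ n.*2 + M n * g x ^+ 2)%:E).
  by under eq_fun do rewrite EFinD; exact: integrableD.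
have bi : m.-integrable [set: T] (fun x => (b x)%:E).
  by rewrite /b; under eq_fun do rewrite EFinM; exact: integrableZl.
have fb x : `|f (s x) * g x| <= b x.
  rewrite normrM /b.
  apply: (le_trans (ler_wpM2r (normr_ge0 _) (fa _ (s_ge0 x)))).
  rewrite -mulrA ler_wpM2l// -[g x ^+ 2]real_normK ?num_real// -muln2 exprM.
  have Mn := M_gt0 n.
  have : 0 <= (s x ^+ n - M n * `|g x|) ^+ 2 / M n.
    by rewrite divr_ge0 ?sqr_ge0// ltW.
  have -> : (s x ^+ n - M n * `|g x|) ^+ 2 / M n =
     (M n)^-1 * (s x ^+ n) ^+ 2 + M n * `|g x| ^+ 2 - 2 * (s x ^+ n * `|g x|).
    by field; rewrite gt_eqF.
  have : 0 <= s x ^+ n * `|g x| by rewrite mulr_ge0 ?exprn_ge0.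
  by lra.
have fi : m.-integrable [set: T] (fun x => (f (s x) * g x)%:E).
  apply: le_integrable bi => //; first exact/measurable_EFinP.
  by move=> x _ /=; rewrite lee_fin (le_trans (fb x))// ler_norm.
split; first exact: fi.
have le1 : `|\int[m]_x (f (s x) * g x)| <= \int[m]_x `|f (s x) * g x|.
  exact: le_normr_Rintegral.
apply: (le_trans le1).
have nfi : m.-integrable [set: T] (fun x => `|f (s x) * g x|%:E).
  exact: (integrable_norm fi).
apply: (@le_trans _ _ (\int[m]_x b x)); first exact: le_Rintegral.
rewrite /b RintegralZl// ler_wpM2l// RintegralD// !RintegralZl// mulrDl lerD//.
- rewrite mulrC ler_pdivrMr//.
  rewrite -lee_fin fineK; last exact: integrable_fin_num si.
  by rewrite -mulrA -expr2.
- by rewrite mulrC.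
Qed.

(** The 1 and the absolute value make [C * M n] positive, as Bang's theorem requires, without a
    discussion of the sign of [K]. *)
Let C : R := 1 + `|(K + \int[mu]_x (g x ^+ 2)) + (K + \int[nu]_x (g x ^+ 2))|.

Let C_gt0 : 0 < C.
Proof. by rewrite ltr_pwDl. Qed.

Let gap_bound f a n : measurable_fun [set: R] f -> 0 <= a ->
  (forall y, 0 <= y -> `|f y| <= a * y ^+ n) ->
  admissible f /\ `|gap f| <= a * (C * M n).
Proof.
move=> mf a0 fa.
have [i1 l1] := Rintegral_bound (mu_moment n) mu_sq mf a0 fa.
have [i2 l2] := Rintegral_bound (nu_moment n) nu_sq mf a0 fa.
split; first by split.
apply: (le_trans (ler_normB _ _)); apply: (le_trans (lerD l1 l2)).
rewrite -mulrDr ler_wpM2l// -mulrDl ler_wpM2r ?(ltW (M_gt0 n))// /C.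
by rewrite (le_trans (ler_norm _))// lerDr.
Qed.

Let mpow n : measurable_fun [set: R] (fun y : R => y ^+ n).
Proof. exact: exprn_measurable. Qed.

Let mcos t k : measurable_fun [set: R] (fun y : R => cosd k (t * y)).
Proof.
rewrite /cosd; apply: (measurableT_comp (f := cos)).
  by apply: continuous_measurable_fun; exact: continuous_cos.
apply: measurable_funD; last exact: measurable_cst.
exact: measurable_funM.
Qed.

Let cosd_le1 k u : `|cosd k u| <= 1 :> R.
Proof. by rewrite ler_norml cos_geN1 cos_le1. Qed.

Let adm_cosd t j k : admissible (fun y => y ^+ j * cosd k (t * y)).
Proof.
have mf : measurable_fun [set: R] (fun y : R => y ^+ j * cosd k (t * y)).
  exact: measurable_funM.
apply: (gap_bound (a := 1) (n := j) mf ler01 _).1 => y y0.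
by rewrite mul1r normrM ger0_norm ?exprn_ge0// ler_piMr ?exprn_ge0.
Qed.

(** The Taylor hypothesis of [bang]. Pointwise, the remainder of cosine for the increment [h * y],
    multiplied by [y ^+ j], is at most [h ^+ m / m!] times [y ^+ (j + m)]; [gap_bound] with exponent
    [j + m] then produces [M (j + m)]. *)
Let gap_cosd_taylor j m (t h : R) : 0 <= t -> 0 <= h ->
  `|gap (fun y => y ^+ j * cosd j ((t + h) * y)) -
    \sum_(i < m) gap (fun y => y ^+ (j + i) * cosd (j + i) (t * y)) *
                 h ^+ i / i`!%:R|
  <= C * M (j + m) * (h ^+ m / m`!%:R).
Proof.
move=> t0 h0.
pose F i y := h ^+ i / i`!%:R * (y ^+ (j + i) * cosd (j + i) (t * y)).
have aF i : admissible (F i) by apply: admissibleZ.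
have [aS gS] := gap_sum (fun i (_ : (i < m)%N) => aF i).
have gF : \sum_(i < m) gap (F i) =
    \sum_(i < m) gap (fun y => y ^+ (j + i) * cosd (j + i) (t * y)) * h ^+ i / i`!%:R.
  by apply: eq_bigr => i _; rewrite /F gapZ// mulrC mulrA.
rewrite -gF -gS -mulN1r -gapZ// -gapD//; last exact: admissibleZ.
rewrite mulrC.
apply: (gap_bound _ _ _).2.
- have [ma _ _] := adm_cosd (t + h) j j; have [mS _ _] := aS.
  by apply: measurable_funD => //; exact: measurable_funM.
- by rewrite divr_ge0 ?exprn_ge0.
move=> y y0; rewrite mulN1r.
have -> : y ^+ j * cosd j ((t + h) * y) - \sum_(i < m) F i y =
    y ^+ j * (cosd j (t * y + h * y) -
              \sum_(i < m) cosd (j + i) (t * y) * (h * y) ^+ i / i`!%:R).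
  rewrite mulrBr mulrDl; congr (_ - _); rewrite mulr_sumr.
  by apply: eq_bigr => i _; rewrite /F exprMn exprD; ring.
rewrite normrM ger0_norm ?exprn_ge0//.
apply: (le_trans (ler_wpM2l _ (cosd_taylor j m (t * y) (mulr_ge0 h0 y0)))).
  by rewrite exprn_ge0.
by rewrite exprMn exprD le_eqVlt; apply/orP; left; apply/eqP; ring.
Qed.

Let cosd0_odd k : odd k -> cosd k 0 = 0 :> R.
Proof.
move=> ok; rewrite /cosd add0r -[k]odd_double_half ok add1n.
elim: k./2 => [|n IHn]; first by rewrite mul1r cos_pihalf.
rewrite doubleS -[in LHS]addn2 natrD mulrDl.
have -> : 2%:R * (pi / 2) = pi :> R by field.
by rewrite cosDpi IHn oppr0.
Qed.

Lemma gap_cos t : gap (fun y => cos (t * y)) = 0.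
Proof.
wlog t0 : t / 0 <= t.
  move=> H; have [t0|t0] := leP 0 t; first exact: H.
  rewrite -[RHS](H (- t)) ?oppr_ge0 ?ltW//.
  by congr gap; apply/funext => y; rewrite mulNr cosN.
pose c j t := gap (fun y => y ^+ j * cosd j (t * y)).
have -> : gap (fun y => cos (t * y)) = c 0%N t.
  by congr gap; apply/funext => y; rewrite expr0 mul1r /cosd mul0r addr0.
apply: (@bang R (fun n => C * M n) c) => //.
- by move=> n; rewrite mulr_gt0.
- move=> n; have -> : C * M n * (C * M n.+2) = C ^+ 2 * (M n * M n.+2) by ring.
  by rewrite exprMn ler_wpM2l// exprn_ge0// ltW.
- move=> B; have [N BN] := M_div B; exists N; rewrite (le_trans BN)//.
  rewrite le_eqVlt; apply/orP; left; apply/eqP; apply: eq_bigr => i _.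
  by rewrite invfM mulrACA mulfV ?mul1r// gt_eqF.
move=> j; rewrite /c.
have -> : (fun y => y ^+ j * cosd j (0 * y)) = (fun y : R => cosd j 0 * y ^+ j).
  by apply/funext => y; rewrite mul0r mulrC.
have aj : admissible (fun y => y ^+ j).
  apply: (gap_bound (a := 1) (n := j) _ ler01 _).1 => // y y0.
  by rewrite mul1r ger0_norm ?exprn_ge0.
(* For odd [j] the cosine factor vanishes at 0; for even [j] the power of [y] is one of those in
   [moments_eq]. *)
rewrite gapZ//; have [oj|ej] := boolP (odd j).
  by rewrite cosd0_odd// mul0r.
have je : j = j./2.*2 by rewrite -[LHS]odd_double_half (negbTE ej).
by rewrite je moments_eq mulr0.
Qed.

Let adm1 f : measurable_fun [set: R] f -> (forall y, 0 <= y -> `|f y| <= 1) ->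
  admissible f.
Proof.
move=> mf f1; apply: (gap_bound (a := 1) (n := 0) mf ler01 _).1 => y y0.
by rewrite expr0 mulr1 f1.
Qed.

Let mcos' t : measurable_fun [set: R] (fun y : R => cos (t * y)).
Proof.
have := mcos t 0; rewrite (_ : (fun _ => _) = (fun y : R => cos (t * y)))//.
by apply/funext => y; rewrite /cosd mul0r addr0.
Qed.

(** The additional factor [cos (u * y)] with free [u] lets the product-to-sum formula carry the
    induction; [u = 0] gives the powers of cosine. *)
Let gap_cosX_cos k t u : gap (fun y => cos (t * y) ^+ k * cos (u * y)) = 0.
Proof.
have cos1 (x : R) : `|cos x| <= 1 by rewrite ler_norml cos_geN1 cos_le1.
have adm j v : admissible (fun y => cos (t * y) ^+ j * cos (v * y)).
  apply: adm1 => [|y y0].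
    by apply: measurable_funM => //; exact: measurable_funX.
  by rewrite normrM normrX mulr_ile1// exprn_ile1.
elim: k u => [|k IHk] u.
  rewrite -(gap_cos u); congr gap.
  by apply/funext => y; rewrite expr0 mul1r.
have -> : (fun y => cos (t * y) ^+ k.+1 * cos (u * y)) = (fun y =>
    2^-1 * (cos (t * y) ^+ k * cos ((t + u) * y)) +
    2^-1 * (cos (t * y) ^+ k * cos ((t - u) * y))).
  by apply/funext => y; rewrite exprS !mulrDl mulNr cosD cosB; field.
rewrite gapD; [|exact: admissibleZ..].
by rewrite !gapZ// !IHk mulr0 addr0.
Qed.

Let gap_horner_cos (p : {poly R}) t :
  (forall y, 0 <= y -> `|p.[cos (t * y)]| <= 1) ->
  measurable_fun [set: R] (fun y : R => p.[cos (t * y)]) /\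
  gap (fun y => p.[cos (t * y)]) = 0.
Proof.
move=> p1.
have cos1 (x : R) : `|cos x| <= 1 by rewrite ler_norml cos_geN1 cos_le1.
have eqp : (fun y => p.[cos (t * y)]) =
    (fun y => \sum_(i < size p) p`_i * cos (t * y) ^+ i).
  by apply/funext => y; rewrite horner_coef.
have adm i : admissible (fun y => cos (t * y) ^+ i).
  apply: adm1 => [|y y0]; first exact: measurable_funX.
  by rewrite normrX exprn_ile1.
have [aS gS] := gap_sum (n := size p) (fun i _ => admissibleZ p`_i (adm i)).
rewrite eqp; split; first by case: aS.
rewrite gS big1// => i _; rewrite gapZ//.
have -> : (fun y => cos (t * y) ^+ i) = (fun y => cos (t * y) ^+ i * cos (0 * y)).
  by apply/funext => y; rewrite mul0r cos0 mulr1.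
by rewrite gap_cosX_cos mulr0.
Qed.

Let gap_lim (F : nat -> R -> R) f :
  (forall n, measurable_fun [set: R] (F n)) -> measurable_fun [set: R] f ->
  (forall n y, 0 <= y -> `|F n y| <= 1) -> (forall y, 0 <= y -> `|f y| <= 1) ->
  (forall y, 0 <= y -> F ^~ y @ \oo --> f y) ->
  (forall n, gap (F n) = 0) -> gap f = 0.
Proof.
move=> mF mf F1 f1 Ff gF.
have [_ i1 i2] := adm1 mf f1.
have lim (m : {measure set T -> \bar R}) :
    m.-integrable [set: T] (fun x => (f (s x) * g x)%:E) ->
    m.-integrable [set: T] (fun x => (1 * g x)%:E) ->
    (fun n => \int[m]_x (F n (s x) * g x)) @ \oo --> \int[m]_x (f (s x) * g x).
  move=> fi gi; apply: fine_cvg; rewrite fineK; last exact: integrable_fin_num.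
  apply: (@dominated_cvg _ _ _ m _ _ _ _ (fun x => `|1 * g x|%:E)) => //.
  - move=> n; apply/measurable_EFinP; apply: measurable_funM => //.
    exact: measurableT_comp.
  - move=> x _; apply: cvg_EFin; first exact: nearW.
    by apply: cvgMl; apply: Ff.
  - exact: (integrable_norm gi).
  - move=> n x _ /=; rewrite lee_fin mul1r normrM ler_piMl//.
    exact: F1.
have [_ g1 g2] : admissible (cst 1).
  by apply: adm1 => // y _; rewrite normr1.
have : (fun n => gap (F n)) @ \oo --> gap f by apply: cvgB; exact: lim.
under eq_fun do rewrite gF.
by move=> /cvg_lim <- //; rewrite lim_cst.
Qed.

Let mlt f h : measurable_fun [set: R] f -> measurable_fun [set: R] h ->
  measurable_fun [set: R] (fun y => (f y < h y)%R%:R : R).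
Proof.
move=> mf mh.
rewrite (_ : (fun _ => _) = (fun y => if f y < h y then 1 else 0 : R)); last first.
  by apply/funext => y; case: ifP.
by apply: measurable_fun_ifT => //; exact: measurable_fun_ltr.
Qed.

Let gap_cos_lt t c : c <= 1 -> gap (fun y => (cos (t * y) < c)%R%:R) = 0.
Proof.
(* The threshold polynomials live on [0, 1], hence the affine rescaling of [-1, 1]. The bound
   [c <= 1] becomes [th <= 1], and for [th <= 0] the indicator is identically 0. *)
move=> c1; pose Y (y : R) := (1 + cos (t * y)) / 2; pose th := (1 + c) / 2.
have Y0 y : 0 <= Y y by have := cos_geN1 (t * y); rewrite /Y; lra.
have Y1 y : Y y <= 1 by have := cos_le1 (t * y); rewrite /Y; lra.
have -> : (fun y => (cos (t * y) < c)%R%:R) = (fun y => (Y y < th)%R%:R) :> (R -> R).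
  by apply/funext => y; rewrite /Y /th ltr_pM2r ?invr_gt0// ltrD2l.
have [th0|th0] := leP th 0.
  rewrite -gap0; congr gap; apply/funext => y /=.
  by rewrite ltNge (le_trans th0 (Y0 y)).
have th1 : th <= 1 by rewrite /th; lra.
pose p n : {poly R} :=
  (1 - (2^-1 *: (1 + 'X)) ^+ n.+1) ^+ Num.trunc (n.+1%:R / th ^+ n.+1).
have pE n y : (p n).[cos (t * y)] =
    (1 - Y y ^+ n.+1) ^+ Num.trunc (n.+1%:R / th ^+ n.+1).
  by rewrite /p /Y !hornerE mulrC.
have p1 n y : `|(p n).[cos (t * y)]| <= 1.
  rewrite pE; have := exprn_ge0 n.+1 (Y0 y); have := exprn_ile1 n.+1 (Y0 y) (Y1 y).
  move: (Y y ^+ _) => z z1 z0; rewrite ger0_norm ?exprn_ge0 ?subr_ge0//.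
  by rewrite exprn_ile1 ?subr_ge0// gerBl.
have gp n := @gap_horner_cos (p n) t (fun y _ => p1 n y).
apply: (gap_lim (F := fun n y => (p n).[cos (t * y)])).
- by move=> n; case: (gp n).
- apply: mlt => //; rewrite /Y; apply: measurable_funM => //.
  exact: measurable_funD.
- by move=> n y _; exact: p1.
- by move=> y _; case: ltP => _ /=; rewrite ?normr1 ?normr0.
- by move=> y _; under eq_fun do rewrite pE; exact: cvg_threshold.
- by move=> n; case: (gp n).
Qed.

Lemma gap_gt b : gap (fun y => (b < y)%R%:R) = 0.
Proof.
(* A half-line with negative end contains every value of [s], so its indicator acts as the moment of
   order 0. From here on [b] lies in the range where cosine can be inverted. *)
have [b0|b0] := ltP b 0.
  have := moments_eq 0; congr (_ = _); rewrite /gap; congr (_ - _);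
    by apply: eq_Rintegral => x _; rewrite expr0 (lt_le_trans b0 (s_ge0 x)).
apply: (gap_lim
  (F := fun n y => (cos (n.+1%:R^-1 * y) < cos (n.+1%:R^-1 * b))%R%:R)).
- by move=> n; exact: mlt.
- exact: mlt.
- by move=> n y _; case: ltP => _ /=; rewrite ?normr1 ?normr0.
- by move=> y _; case: ltP => _ /=; rewrite ?normr1 ?normr0.
(* As soon as [y / n.+1] and [b / n.+1] lie in [0, pi], where cosine decreases, the two indicators
   coincide. The convergence is thus eventual equality, from an index depending on [y]. *)
- move=> y y0; apply: cvg_near_cst.
  have small z : 0 <= z -> \forall n \near \oo, n.+1%:R^-1 * z \in `[(0 : R), pi].
    move=> z0; exists (Num.bound (z / pi)) => // n /= zn.
    rewrite in_itv/= mulr_ge0//= mulrC ler_pdivrMr// mulrC -ler_pdivrMr ?pi_gt0//.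
    apply: (le_trans (ltW (archi_boundP _))); first by rewrite divr_ge0// pi_ge0.
    by rewrite ler_nat (leq_trans zn).
  near=> n; rewrite ltr_cos.
  + by rewrite ltr_pM2l// invr_gt0.
  + by near: n; exact: small.
  + by near: n; exact: small.
- by move=> n; apply: gap_cos_lt; exact: cos_le1.
Unshelve. all: by end_near. Qed.

End Carleman.
End MomentGap.

(** * Quasi-analytic weights *)

Section QuasiAnalyticMajorant.
Context {R : realType}.

Lemma nneseries_unbounded (G : nat -> R) :
  (forall n, 0 <= G n) -> (\sum_(1 <= m <oo) (G m.-1)%:E = +oo)%E ->
  forall B, exists N, B <= \sum_(n < N) G n.
Proof.
move=> G0 Goo B; apply: contrapT => /forallNP HB.
suff : (\sum_(1 <= m <oo) (G m.-1)%:E <= B%:E)%E by rewrite Goo leye_eq.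
apply: lime_le; first by apply: is_cvg_nneseries => n _ _; rewrite lee_fin.
apply: nearW => N; rewrite sumEFin lee_fin.
have -> : \sum_(1 <= i < N) G i.-1 = \sum_(n < N.-1) G n.
  case: N => [|N]; first by rewrite big_geq// big_ord0.
  by rewrite big_add1 big_mkord.
by have /negP := HB N.-1; rewrite -ltNge => /ltW.
Qed.

(* For a measure on the cone only the even powers s^(2n) = x^n are polynomial
   moments, hence the passage to sqrt (Q (2n)). *)
Section EvenSubsequence.
Variable Q : nat -> R.
Hypothesis Q_gt0 : forall n, 0 < Q n.
Hypothesis Q_logconvex : forall n, Q n.+1 ^+ 2 <= Q n * Q n.+2.
Hypothesis Q_div : forall B, exists N, B <= \sum_(n < N) Q n / Q n.+1.

Let al n := Q n / Q n.+1.

Let al_gt0 n : 0 < al n. Proof. exact: divr_gt0. Qed.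

Let al_nincr n : al n.+1 <= al n.
Proof. by rewrite /al ler_pdivrMr// mulrAC ler_pdivlMr// -expr2. Qed.

Lemma sqrt_even_majorant :
  let M n := Num.sqrt (Q n.*2) in
  [/\ (forall n, 0 < M n), (forall n, M n.+1 ^+ 2 <= M n * M n.+2)
    & forall B, exists N, B <= \sum_(n < N) M n / M n.+1].
Proof.
move=> M; have M0 n : 0 < M n by rewrite sqrtr_gt0.
have QM n : Q n.*2 / Q n.+1.*2 = al n.*2 * al n.*2.+1.
  by rewrite /al doubleS mulrA divfK// gt_eqF.
have ME n : M n / M n.+1 = Num.sqrt (al n.*2 * al n.*2.+1).
  by rewrite -QM sqrtrM ?sqrtrV// ltW.
split=> //.
- move=> n; have : M n.+1 / M n.+2 <= M n / M n.+1.
    rewrite !ME ler_wsqrtr// ler_pM ?(ltW (al_gt0 _))//.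
      by rewrite doubleS (le_trans (al_nincr _)).
    by rewrite doubleS (le_trans (al_nincr _)).
  by rewrite ler_pdivrMr// mulrAC ler_pdivlMr// -expr2.
- move=> B; have [N BN] := Q_div (2 * B + al 0); exists N.
  (* The ratios [al] are nonincreasing, so up to [al 0] those of odd index carry at least half of
     the sum. The ratio [M n / M n.+1] is the geometric mean of two neighbours and hence at least
     the odd one. *)
  have le1 : al 0 + 2 * \sum_(n < N) al n.*2.+1 >= \sum_(n < N.*2.+1) al n.
    elim: (N) => [|n IHn]; first by rewrite big_ord1 big_ord0 mulr0 addr0.
    rewrite doubleS !big_ord_recr/= -/(al _) in IHn *.
    have := al_nincr n.*2.+1; lra.
  have le2 : \sum_(n < N) al n <= \sum_(n < N.*2.+1) al n.
    rewrite -addnn -addnS big_split_ord/= lerDl sumr_ge0// => i _.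
    exact: ltW.
  have le3 : \sum_(n < N) al n.*2.+1 <= \sum_(n < N) M n / M n.+1.
    apply: ler_sum => i _; rewrite ME -[leLHS]ger0_norm ?(ltW (al_gt0 _))// -sqrtr_sqr.
    by rewrite ler_wsqrtr// expr2 ler_pM2r.
  rewrite -/(al _) in BN; lra.
Qed.

End EvenSubsequence.

Lemma quasi_analytic_majorant n (a w : 'rV[R]_n -> R) : weight w ->
  (\sum_(1 <= m <oo)
     (sup_norm (fun x => a x ^+ m * w x)%R `^ (m%:R^-1)%R)^-1 = +oo)%E ->
  exists M : nat -> R,
  [/\ (forall k, 0 < M k), (forall k, M k.+1 ^+ 2 <= M k * M k.+2),
     (forall B, exists N, B <= \sum_(k < N) M k / M k.+1)
    & forall k x, a x ^+ k.*2 * w x <= M k ^+ 2].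
Proof.
move=> [w0 wb] qa.
have [B [B1 wB]] : exists B, 1 <= B /\ forall x, w x <= B.
  have [B0 [_ /(_ (`|B0| + 1))]] := wb.
  rewrite (le_lt_trans (ler_norm _)) ?ltrDl// => /(_ isT) wB.
  exists (`|B0| + 1); split; first by rewrite lerDr.
  by move=> x; rewrite (le_trans (ler_norm _)) ?wB.
pose S m := sup_norm (fun x => a x ^+ m * w x).
have Sub m x : ((`|a x ^+ m * w x|)%:E <= S m)%E.
  by apply: ereal_sup_ubound; exists x.
have Slub m b : (forall x, `|a x ^+ m * w x| <= b) -> (S m <= b%:E)%E.
  by move=> H; apply: ge_ereal_sup => _ [x _ <-]; rewrite lee_fin.
have [[x0 x0P]|/forallNP aw0] := pselect (exists x, a x * w x != 0); last first.
  (* Every sup norm of positive order is 0, so a constant sequence will do. *)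
  have {}aw0 x : a x * w x = 0 by apply: contrapT => /eqP H; exact: (aw0 x).
  exists (fun=> B); split.
  - by move=> _; apply: lt_le_trans B1.
  - by move=> _; rewrite expr2.
  - move=> b; exists (Num.bound `|b|).
    rewrite divff; last by rewrite gt_eqF// (lt_le_trans _ B1).
    rewrite sumr_const card_ord (le_trans (ler_norm _))//.
    by rewrite ltW// archi_boundP.
  move=> [|k] x.
    by rewrite expr0 mul1r (le_trans (wB x))// expr2 ler_peMr// (le_trans ler01).
  by rewrite doubleS exprSr -mulrA aw0 mulr0 sqr_ge0.
have Sgt0 m : (0 < S m)%E.
  apply: lt_le_trans (Sub m x0); rewrite lte_fin normr_gt0.
  by move: x0P; rewrite !mulf_eq0 !negb_or => /andP[a0 ->]; rewrite expf_neq0.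
have Slty m : (S m < +oo)%E.
  rewrite ltey; apply/negP => /eqP Sm.
  (* An infinite sup norm forces all later ones to be infinite, since [|a| ^ m] is at most 1 or at
     most [|a| ^ k] and [w] is bounded. The series would then have only finitely many nonzero terms,
     all finite. *)
  have Soo k : (m <= k)%N -> S k = +oo%E.
    move=> mk; apply/eqP; rewrite -leye_eq -Sm.
    have [/fineK Sk|] := boolP (S k \is a fin_num); last first.
      rewrite fin_numElt (lt_trans _ (Sgt0 k))//= -leNgt leye_eq.
      by move/eqP ->; exact: leey.
    suff : (S m <= (B + fine (S k))%:E)%E by rewrite Sm leye_eq.
    apply: Slub => x; rewrite normrM normrX (ger0_norm (w0 x)).
    have Skx : `|a x| ^+ k * w x <= fine (S k).
      by have := Sub k x; rewrite -Sk lee_fin normrM normrX (ger0_norm (w0 x)).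
    have [a1|a1] := leP (`|a x|) 1.
    - apply: (@le_trans _ _ (1 * w x)).
        by rewrite ler_wpM2r// exprn_ile1.
      rewrite mul1r (le_trans (wB x))// lerDl -lee_fin Sk ltW//.
    - apply: (@le_trans _ _ (`|a x| ^+ k * w x)).
        by rewrite ler_wpM2r// ler_weXn2l// ltW.
      by rewrite (le_trans Skx)// lerDr (le_trans ler01).
  have m0 : (0 < m)%N.
    rewrite lt0n; apply/eqP => m0; have : (S m <= B%:E)%E.
      by apply: Slub => x; rewrite m0 expr0 mul1r ger0_norm.
    by rewrite Sm leye_eq.
  move: qa; rewrite (nneseries_split _ m); last first.
    by move=> k _; rewrite inve_ge0 poweR_ge0.
  rewrite eseries0 ?adde0; last first.
    move=> k mk _; rewrite -/(S k) Soo ?poweRyr ?invey//.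
      by rewrite invr_eq0 pnatr_eq0 -lt0n (leq_trans m0)// (leq_trans _ mk)// leq_addl.
    by rewrite (leq_trans _ mk)// leq_addl.
  apply/eqP; rewrite -ltey; apply: lte_sum_pinfty => k _.
  rewrite ltey inve_eqy -/(S k) gt_eqF// poweR_gt0//.
pose Q m := fine (S m).
have QE m : (Q m)%:E = S m.
  by rewrite fineK// fin_numElt Slty (lt_trans _ (Sgt0 m)).
have Q0 m : 0 < Q m by rewrite -lte_fin QE.
have Qub m x : `|a x ^+ m * w x| <= Q m by rewrite -lee_fin QE.
have Qlub m b : (forall x, `|a x ^+ m * w x| <= b) -> Q m <= b.
  by move=> H; rewrite -lee_fin QE; exact: Slub.
(* Pointwise the square of [a ^ (m + 1) * w] equals the product of its two neighbours; taking
   suprema gives the inequality. *)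
have Qlc m : Q m.+1 ^+ 2 <= Q m * Q m.+2.
  have q0 : 0 <= Q m * Q m.+2 by rewrite ltW// mulr_gt0.
  rewrite -[leRHS](sqr_sqrtr q0) lerXn2r ?nnegrE ?sqrtr_ge0//; first exact: ltW.
  apply: Qlub => x; rewrite -[leLHS]normr_id -sqrtr_sqr ler_wsqrtr//.
  apply: le_trans (ler_pM _ _ (Qub m x) (Qub m.+2 x)) => //.
  rewrite -normrM real_normK ?num_real//; apply: le_trans (ler_norm _).
  by rewrite le_eqVlt; apply/orP; left; apply/eqP; rewrite !exprS; ring.
pose G n := (Q n.+1 `^ (n.+1%:R^-1))^-1.
have G0 n' : 0 <= G n' by rewrite invr_ge0 powR_ge0.
have Goo : (\sum_(1 <= m <oo) (G m.-1)%:E = +oo)%E.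
  rewrite -qa; apply: congr_lim; apply/funext => N; apply: eq_big_nat => -[//|m] _.
  by rewrite -/(S _) -QE poweR_EFin inver gt_eqF ?powR_gt0// Q0.
(* The product of the ratios is [Q 0 / Q m.+1], so [G m] is their geometric mean up to a power of
   [Q 0]. A constant [c] that is at least 1 and at least [(Q 0)^-1] absorbs it for every [m], since
   [c <= c ^+ m.+1]. *)
pose c := Num.max 1 (Q 0)^-1.
have c1 : 1 <= c by rewrite le_max lexx.
have GX m : G m ^+ m.+1 <= \prod_(j < m.+1) (c * (Q j / Q j.+1)).
  have -> : G m ^+ m.+1 = (Q m.+1)^-1.
    rewrite exprVn -powR_mulrn ?powR_ge0// -powRrM mulVf ?pnatr_eq0//.
    by rewrite powRr1// ltW.
  have -> : (Q m.+1)^-1 = (Q 0)^-1 * \prod_(j < m.+1) (Q j / Q j.+1).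
    elim: m => [|m IHm].
      by rewrite big_ord1 mulrA mulVf ?mul1r// gt_eqF.
    by rewrite big_ord_recr/= [RHS]mulrA -IHm [RHS]mulrA mulVf ?mul1r// gt_eqF.
  rewrite [leRHS]big_split/= prodr_const card_ord ler_wpM2r//.
    by apply: prodr_ge0 => j _; rewrite divr_ge0// ltW.
  rewrite (@le_trans _ _ c) ?le_max ?lexx ?orbT// exprS ler_peMr//.
    by rewrite (le_trans ler01).
  by rewrite exprn_ege1.
have Qdiv b : exists N, b <= \sum_(j < N) Q j / Q j.+1.
  have [N bN] := nneseries_unbounded G0 Goo (expR 1 * c * b); exists N.
  have al0 j : 0 <= c * (Q j / Q j.+1).
    by rewrite mulr_ge0// ?(le_trans ler01 c1)// divr_ge0// ltW.
  have := le_trans bN (carleman_ineq N al0 G0 GX).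
  rewrite -mulr_sumr mulrA ler_pM2l// mulr_gt0 ?expR_gt0//.
  exact: lt_le_trans c1.
have [M0 Mlc Mdiv] := sqrt_even_majorant Q0 Qlc Qdiv.
exists (fun k => Num.sqrt (Q k.*2)); split => // k x.
by rewrite sqr_sqrtr ?(ltW (Q0 _))//; exact: le_trans (ler_norm _) (Qub _ _).
Qed.

End QuasiAnalyticMajorant.

(** * Borel sets and dual bases *)

Section BorelRow.
Context {R : realType} {n : nat}.

Lemma measurable_open_rV (U : set 'rV[R]_n) : open U ->
  measurable (U : set (borel_rV R n)).
Proof. exact: sub_sigma_algebra. Qed.

Lemma continuous_measurable_rV (f : 'rV[R]_n -> R) : continuous f ->
  measurable_fun [set: borel_rV R n] (f : borel_rV R n -> R).
Proof.
move=> cf; apply: (measurability (RGenOpens.G (R := R))).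
  exact: RGenOpens.measurableE.
move=> _ [_ [a [b ->]] <-]; rewrite setTI; apply: measurable_open_rV.
apply: open_comp; first by move=> x _; exact: cf.
exact: interval_open.
Qed.

Lemma continuous_measurable_rV_rV (f : 'rV[R]_n -> 'rV[R]_n) : continuous f ->
  measurable_fun [set: borel_rV R n] (f : borel_rV R n -> borel_rV R n).
Proof.
move=> cf; apply: (@measurability _ _ (borel_rV R n) (borel_rV R n) setT f (@open 'rV[R]_n)) => //.
move=> _ [U oU <-]; rewrite setTI; apply: measurable_open_rV.
by apply: open_comp => // x _; exact: cf.
Qed.

Lemma continuous_bigsum (T : topologicalType) (V : normedModType R) (I : Type)
    (r : seq I) (F : I -> T -> V) :
  (forall i, continuous (F i)) -> continuous (fun x => \sum_(i <- r) F i x).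
Proof.
move=> cF; elim: r => [|i r IHr] x.
  rewrite (_ : (fun _ => _) = cst 0); first exact: cvg_cst.
  by apply/funext => y; rewrite big_nil.
rewrite (_ : (fun _ => _) = (fun x => F i x + \sum_(j <- r) F j x)).
  by apply: cvgD; [exact: cF|exact: IHr].
by apply/funext => y; rewrite big_cons.
Qed.

Lemma dotp_is_linear (u : 'rV[R]_n) : linear (dotp u).
Proof.
move=> a x y; rewrite /dotp /GRing.scale/= mulr_sumr -big_split/=.
by apply: eq_bigr => i _; rewrite !mxE; ring.
Qed.

HB.instance Definition _ (u : 'rV[R]_n) :=
  GRing.isLinear.Build R 'rV[R]_n R _ (dotp u) (dotp_is_linear u).

Lemma continuous_dotp (u : 'rV[R]_n) : continuous (dotp u).
Proof.
apply: continuous_bigsum => i x.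
by apply: continuousM; [exact: cst_continuous|exact: coord_continuous].
Qed.

Lemma measurable_dotp (u : 'rV[R]_n) :
  measurable_fun [set: borel_rV R n] (dotp u : borel_rV R n -> R).
Proof. by apply: continuous_measurable_rV; exact: continuous_dotp. Qed.

Lemma norm_coord_le_enorm (x : 'rV[R]_n) l : `|x 0 l| <= enorm x.
Proof.
rewrite /enorm -sqrtr_sqr ler_wsqrtr// /dotp (bigD1 l)//= expr2 lerDl.
by apply: sumr_ge0 => i _; rewrite -expr2 sqr_ge0.
Qed.

Lemma enorm_le_sum (x : 'rV[R]_n) : enorm x <= \sum_l `|x 0 l|.
Proof.
have s0 : 0 <= \sum_l `|x 0 l| by apply: sumr_ge0.
rewrite /enorm -[leRHS]ger0_norm// -sqrtr_sqr ler_wsqrtr// expr2 /dotp.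
rewrite mulr_suml; apply: ler_sum => l _.
rewrite -expr2 -real_normK ?num_real// expr2 ler_wpM2l//.
by rewrite (bigD1 l)//= lerDl sumr_ge0.
Qed.

(** * Dual coordinates and the boxes they define *)

Section DualBasis.
Variables v v' : n.-tuple 'rV[R]_n.
Hypothesis v_basis : basis_of fullv v.
Hypothesis v'_dual : forall i j : 'I_n, dotp (tnth v' i) (tnth v j) = (i == j)%:R.

Lemma dotp_dual_sum (c : 'I_n -> R) i :
  dotp (tnth v' i) (\sum_j c j *: tnth v j) = c i.
Proof.
rewrite linear_sum (bigD1 i)//= linearZ/= v'_dual eqxx big1 ?addr0.
  by rewrite /GRing.scale/= mulr1.
move=> j ji; rewrite linearZ/= v'_dual eq_sym (negbTE ji).
by rewrite /GRing.scale/= mulr0.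
Qed.

Lemma coord_dualE j x : coord v j x = dotp (tnth v' j) x.
Proof.
rewrite {2}(coord_basis v_basis (memvf x)).
under eq_bigr do rewrite -tnth_nth.
by rewrite dotp_dual_sum.
Qed.

Lemma dual_decomp x : x = \sum_j dotp (tnth v' j) x *: tnth v j.
Proof.
rewrite {1}(coord_basis v_basis (memvf x)); apply: eq_bigr => j _.
by rewrite -tnth_nth coord_dualE.
Qed.

Lemma pos_coneE : pos_cone v = [set x | forall j, 0 <= dotp (tnth v' j) x].
Proof.
apply/seteqP; split=> x /=.
  by move=> [c [c0 ->]] j; rewrite dotp_dual_sum.
move=> x0; exists (fun j => dotp (tnth v' j) x); split => //.
exact: dual_decomp.
Qed.

Lemma dotp_cone_sqrt j x :
  dotp (tnth v' j) (cone_sqrt v x) = Num.sqrt (dotp (tnth v' j) x).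
Proof. by rewrite dotp_dual_sum coord_dualE. Qed.

Lemma continuous_cone_sqrt : continuous (cone_sqrt v).
Proof.
have cf j : continuous (fun x => Num.sqrt (coord v j x)).
  rewrite (_ : (fun _ => _) = Num.sqrt \o dotp (tnth v' j)); last first.
    by apply/funext => y; rewrite coord_dualE.
  move=> y; apply: continuous_comp; first exact: continuous_dotp.
  exact: sqrt_continuous.
apply: continuous_bigsum => j x.
exact: (@continuousZr_tmp _ _ _ (fun x => Num.sqrt (coord v j x)) (tnth v j) x (cf j x)).
Qed.

Lemma norm_coord_le_dual (x : 'rV[R]_n) l :
  `|x 0 l| <= \sum_j `|dotp (tnth v' j) x| * `|tnth v j 0 l|.
Proof.
rewrite {1}(dual_decomp x) summxE (le_trans (ler_norm_sum _ _ _))//.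
by apply: ler_sum => j _; rewrite mxE normrM.
Qed.

Definition upper_box (a : 'I_n -> R) : set (borel_rV R n) :=
  [set x | forall j, a j < dotp (tnth v' j) x].

Lemma measurable_pos_cone : measurable (pos_cone v : set (borel_rV R n)).
Proof.
rewrite pos_coneE.
rewrite (_ : [set _ | _] = \bigcap_(j in [set: 'I_n])
    [set x : borel_rV R n | 0 <= dotp (tnth v' j) x]); last first.
  by apply/seteqP; split=> [x + j _|x + j]; [exact|move=> /(_ j I)].
apply: fin_bigcap_measurable => // j _.
have := measurable_dotp (tnth v' j) measurableT (measurable_itv `[0, +oo[).
rewrite setTI; congr measurable; apply/seteqP; split => x /=.
  by rewrite in_itv/= andbT.
by rewrite in_itv/= andbT.
Qed.

Lemma measurable_upper_box a : measurable (upper_box a).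
Proof.
rewrite (_ : upper_box a = \bigcap_(j in [set: 'I_n])
    [set x : borel_rV R n | a j < dotp (tnth v' j) x]); last first.
  by apply/seteqP; split=> [x + j _|x + j]; [exact|move=> /(_ j I)].
apply: fin_bigcap_measurable => // j _.
have := measurable_dotp (tnth v' j) measurableT (measurable_itv `]a j, +oo[).
rewrite setTI; congr measurable; apply/seteqP; split => x /=.
  by rewrite in_itv/= andbT.
by rewrite in_itv/= andbT.
Qed.

Let half_space j q : <<s range upper_box >>
  [set x : borel_rV R n | q < dotp (tnth v' j) x].
Proof.
pose a (k : nat) (i : 'I_n) : R := if i == j then q else - k%:R.
rewrite (_ : [set x | _] = \bigcup_k upper_box (a k)).
  by apply: sigma_algebra_bigcup => k; apply: sub_sigma_algebra; exists (a k).
apply/seteqP; split => x /=; last first.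
  by move=> [k _ /(_ j)]; rewrite /a eqxx.
move=> qx; exists (Num.bound (\sum_i `|dotp (tnth v' i) x|)) => // i.
rewrite /a; case: eqP => [->//|_].
rewrite ltrNl (le_lt_trans (ler_norm _))// normrN.
apply: le_lt_trans (archi_boundP _); last by apply: sumr_ge0.
by rewrite (bigD1 i)//= lerDl sumr_ge0.
Qed.

(** An open set is the union of the half-open boxes with rational ends in the dual coordinates that
    it contains. There are countably many, and each is a finite intersection of differences of
    half-spaces. *)
Lemma sub_generated_upper_box : @open 'rV[R]_n `<=` <<s range upper_box >>.
Proof.
move=> U oU.
pose box (pq : {ffun 'I_n -> rat} * {ffun 'I_n -> rat}) :=
  [set x : 'rV[R]_n | forall j,
    ratr (pq.1 j) < dotp (tnth v' j) x /\ dotp (tnth v' j) x <= ratr (pq.2 j)].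
have mbox pq : <<s range upper_box >> (box pq).
  rewrite (_ : box pq = \bigcap_(j in [set: 'I_n])
      ([set x | ratr (pq.1 j) < dotp (tnth v' j) x] `\`
       [set x | ratr (pq.2 j) < dotp (tnth v' j) x])).
    apply: (@fin_bigcap_measurable _ (g_sigma_algebraType (range upper_box))) => // j _.
    by apply: measurableD; exact: half_space.
  apply/seteqP; split => x /=.
    by move=> bx j _; have [? ?] := bx j; split => //; apply/negP; rewrite -leNgt.
  by move=> bx j; have [/= ? /negP] := bx j I; rewrite -leNgt.
rewrite (_ : U = \bigcup_pq (if pselect (box pq `<=` U) then box pq else set0)).
  apply: (@countable_bigcupT_measurable _ (g_sigma_algebraType (range upper_box))).
    exact: countableP.
  by move=> pq; case: pselect => [?|?] /=; [exact: mbox|exact: measurable0].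
apply/seteqP; split => x; last first.
  by move=> [pq _]; case: pselect => [sub|?] //=; exact: sub.
move=> Ux; have /nbhs_ballP[e /= e0 eU] : nbhs x U by exact: open_nbhs_nbhs.
(* Dual coordinates within [d] move each standard coordinate by at most [d] times the double sum;
   the 1 makes [c] positive and the final inequality strict. *)
pose c := 1 + \sum_j \sum_l `|tnth v j 0 l|.
have c0 : 0 < c by rewrite ltr_pwDl// sumr_ge0// => j _; exact: sumr_ge0.
pose d := e / c.
have d0 : 0 < d by rewrite divr_gt0.
have /choice[p pP] j : exists q : rat, ratr q \in `]dotp (tnth v' j) x - d, dotp (tnth v' j) x[.
  by apply: rat_in_itvoo; rewrite gtrBl.
have /choice[q qP] j : exists q : rat, ratr q \in `]dotp (tnth v' j) x, dotp (tnth v' j) x + d[.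
  by apply: rat_in_itvoo; rewrite ltrDl.
exists ([ffun j => p j], [ffun j => q j]) => //; case: pselect => [sub j /=|[]].
  rewrite !ffunE; have := pP j; have := qP j.
  by rewrite !in_itv/= => /andP[/ltW ? _] /andP[].
move=> y /= yb; apply: eU; split => // i l; rewrite /ball/= (ord1 i).
have yx j : `|dotp (tnth v' j) (x - y)| <= d.
  have [] := yb j; rewrite !ffunE linearB/=.
  have := pP j; have := qP j; rewrite !in_itv/= ler_norml.
  by move=> /andP[? ?] /andP[? ?] ? ?; apply/andP; split; lra.
have := norm_coord_le_dual (x - y) l; rewrite !mxE => /le_lt_trans; apply.
apply: (@le_lt_trans _ _ (d * \sum_j \sum_l `|tnth v j 0 l|)).
  rewrite mulr_sumr; apply: ler_sum => j _; apply: ler_pM => //.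
  by rewrite (bigD1 l)//= lerDl sumr_ge0.
have -> : e = d * c by rewrite /d divfK// gt_eqF.
by rewrite ltr_pM2l// /c ltrDr.
Qed.

Lemma measure_eq_of_upper_box (mu nu : {measure set (borel_rV R n) -> \bar R}) :
  (mu setT < +oo)%E -> (forall a, mu (upper_box a) = nu (upper_box a)) ->
  forall A, measurable A -> nu A = mu A.
Proof.
move=> mufin munu A mA; apply/esym.
apply: (@g_sigma_algebra_measure_unique _ _ _ (range upper_box) _
  (fun k => upper_box (fun=> - k%:R))).
- by move=> _ [a _ <-]; exact: measurable_upper_box.
- by move=> k; exists (fun=> - k%:R).
- apply/seteqP; split => // x _.
  exists (Num.bound (\sum_i `|dotp (tnth v' i) x|)) => // i.
  rewrite ltrNl (le_lt_trans (ler_norm _))// normrN.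
  apply: le_lt_trans (archi_boundP _); last by apply: sumr_ge0.
  by rewrite (bigD1 i)//= lerDl sumr_ge0.
- move=> _ _ [a _ <-] [b _ <-]; exists (fun j => Num.max (a j) (b j)) => //.
  apply/seteqP; split => x /=.
    by move=> ab; split=> j; have := ab j; rewrite gt_max => /andP[].
  by move=> [ax bx] j; rewrite gt_max ax bx.
- by move=> _ [a _ <-].
- move=> k; apply: le_lt_trans mufin; apply: le_measure => //; rewrite inE//.
  exact: measurable_upper_box.
- apply: smallest_sub mA; first exact: smallest_sigma_algebra.
  exact: sub_generated_upper_box.
Qed.

End DualBasis.
End BorelRow.

(** * All coordinates *)

Section ProductIndicators.
Context d (T : measurableType d) (R : realType) (n : nat).
Variables (mu nu : {measure set T -> \bar R}) (s : 'I_n -> T -> R).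
Variables (M : 'I_n -> nat -> R) (K : R).

(** A single function whose powers dominate all the mixed products of indicators and even powers, so
    that integrability need only be assumed for it. *)
Definition scale (x : T) : R := 1 + \sum_j s j x ^+ 2.

Hypothesis ms : forall j, measurable_fun [set: T] (s j).
Hypothesis s_ge0 : forall j x, 0 <= s j x.
Hypothesis M_gt0 : forall j k, 0 < M j k.
Hypothesis M_logconvex : forall j k, M j k.+1 ^+ 2 <= M j k * M j k.+2.
Hypothesis M_div : forall j B, exists N, B <= \sum_(k < N) M j k / M j k.+1.
Hypothesis mu_moment : forall j k,
  (\int[mu]_x (s j x ^+ k.*2)%:E <= (K * M j k ^+ 2)%:E)%E.
Hypothesis nu_moment : forall j k,
  (\int[nu]_x (s j x ^+ k.*2)%:E <= (K * M j k ^+ 2)%:E)%E.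
Hypothesis mu_scale : forall k, mu.-integrable [set: T] (fun x => (scale x ^+ k)%:E).
Hypothesis nu_scale : forall k, nu.-integrable [set: T] (fun x => (scale x ^+ k)%:E).
Hypothesis moments_eq : forall k : 'I_n -> nat,
  \int[mu]_x (\prod_i s i x ^+ (k i).*2) = \int[nu]_x (\prod_i s i x ^+ (k i).*2).

Let scale_ge1 x : 1 <= scale x.
Proof. by rewrite lerDl sumr_ge0// => j _; rewrite exprn_ge0. Qed.

Let scale_ge0 x : 0 <= scale x. Proof. exact: le_trans (scale_ge1 x). Qed.

Variable b : 'I_n -> R.

Let F m (k : 'I_n -> nat) (i : 'I_n) x : R :=
  if (i < m)%N then (b i < s i x)%R%:R else s i x ^+ (k i).*2.

Let F_ge0 m k i x : 0 <= F m k i x.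
Proof. by rewrite /F; case: ifP => _; rewrite ?exprn_ge0. Qed.

Let F_le m k i x : F m k i x <= scale x ^+ k i.
Proof.
rewrite /F; case: ifP => _.
  by apply: (@le_trans _ _ 1); rewrite ?exprn_ege1//; case: ltP.
rewrite -mul2n exprM lerXn2r ?nnegrE ?exprn_ge0//.
by rewrite /scale (bigD1 i)//= addrCA lerDl addr_ge0// sumr_ge0// => j _; rewrite exprn_ge0.
Qed.

Let mF m k i : measurable_fun [set: T] (F m k i).
Proof.
rewrite /F; case: (i < m)%N; last exact: measurable_funX.
rewrite (_ : (fun _ => _) = (fun x => if b i < s i x then 1 else 0 : R)); last first.
  by apply/funext => x; case: ifP.
by apply: measurable_fun_ifT => //; exact: measurable_fun_ltr.
Qed.

Let mG m k (P : pred 'I_n) :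
  measurable_fun [set: T] (fun x => \prod_(i | P i) F m k i x).
Proof.
under eq_fun do rewrite big_mkcond.
apply: measurable_prod => i _; case: (P i) => //; exact: mF.
Qed.

Let G_sq m k (P : pred 'I_n) (p : {measure set T -> \bar R}) :
  (forall j, p.-integrable [set: T] (fun x => (scale x ^+ j)%:E)) ->
  p.-integrable [set: T] (fun x => ((\prod_(i | P i) F m k i x) ^+ 2)%:E).
Proof.
move=> ip; apply: le_integrable (ip (\sum_(i | P i) k i * 2)%N) => //.
  by apply/measurable_EFinP; exact: measurable_funX.
move=> x _ /=; rewrite lee_fin !ger0_norm ?exprn_ge0//; last exact: prodr_ge0.
rewrite -big_distrl/= exprM lerXn2r ?nnegrE ?exprn_ge0//; first exact: prodr_ge0.
rewrite -prodrXr; apply: ler_prod => i _.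
by rewrite F_ge0 F_le.
Qed.

(** The exponents [k] stay general in the induction: replacing one power by an indicator uses the
    previous equality for all powers of that coordinate, with the other factors held fixed. *)
Let Rintegral_F_eq m : (m <= n)%N -> forall k,
  \int[mu]_x (\prod_i F m k i x) = \int[nu]_x (\prod_i F m k i x).
Proof.
elim: m => [|m IHm] mn k.
  exact: moments_eq.
pose i0 := Ordinal mn; pose g x := \prod_(i | i != i0) F m k i x.
have Fsplit x : \prod_i F m.+1 k i x = (b i0 < s i0 x)%R%:R * g x.
  rewrite (bigD1 i0)//= {1}/F /= ltnSn; congr (_ * _).
  apply: eq_bigr => i ii0; rewrite /F ltnS leq_eqVlt.
  by case: eqP => // im; move: ii0; rewrite -val_eqE/= im eqxx.
have : gap mu nu (s i0) g (fun y => (b i0 < y)%R%:R) = 0.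
  apply: (gap_gt (M := M i0) (K := K)) => //.
  - exact: mG.
  - exact: G_sq.
  - exact: G_sq.
  - move=> j; pose k' i := if i == i0 then j else k i.
    have gE x : s i0 x ^+ j.*2 * g x = \prod_i F m k' i x.
      have Fi0 : F m k' i0 x = s i0 x ^+ j.*2 by rewrite /F /= ltnn /k' eqxx.
      rewrite [RHS](bigD1 i0)//= Fi0; congr (_ * _).
      by apply: eq_bigr => i /negbTE ii0; rewrite /F /k' ii0.
    rewrite /gap; under eq_Rintegral do rewrite gE.
    under [X in _ - X = _]eq_Rintegral do rewrite gE.
    by rewrite IHm ?subrr// ltnW.
rewrite /gap => /subr0_eq H.
under eq_Rintegral do rewrite Fsplit.
by under [RHS]eq_Rintegral do rewrite Fsplit.
Qed.

Lemma measure_upper_orthant_eq :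
  mu [set x | forall i, b i < s i x] = nu [set x | forall i, b i < s i x].
Proof.
set A := [set x | _].
have AE : A = \bigcap_(i in [set: 'I_n]) (s i @^-1` `]b i, +oo[).
  apply/seteqP; split => x /=.
    by move=> Ax i _ /=; rewrite in_itv/= andbT.
  by move=> Ax i; have := Ax i I; rewrite /= in_itv/= andbT.
have mA : measurable A.
  rewrite AE; apply: fin_bigcap_measurable => // i _.
  by rewrite -[X in measurable X]setTI; exact: ms.
have finA (p : {measure set T -> \bar R}) :
    (forall j, p.-integrable [set: T] (fun x => (scale x ^+ j)%:E)) ->
    p A \is a fin_num.
  move=> ip; rewrite ge0_fin_numE//.
  have /integrableP[_] := ip 0.
  under eq_integral do rewrite expr0 abse_EFin normr1.
  rewrite integral_cst// mul1e; apply: le_lt_trans.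
  by apply: le_measure; rewrite ?inE.
have prodE x : \prod_i F n (fun=> 0%N) i x = \1_A x.
  rewrite indicE; have [Ax|nAx] := boolP (x \in A).
    rewrite big1// => i _; rewrite /F ltn_ord.
    by move: Ax; rewrite inE => ->.
  have [i /negP bi] : exists i, ~ b i < s i x.
    by apply/existsNP => Ax; move: nAx; rewrite notin_setE; apply.
  by rewrite (bigD1 i)//= {1}/F ltn_ord (negbTE bi) mul0r.
have := Rintegral_F_eq (leqnn n) (fun=> 0%N).
under eq_Rintegral do rewrite prodE.
under [X in _ = X -> _]eq_Rintegral do rewrite prodE.
rewrite /Rintegral !integral_indic// !setIT => munuA.
by rewrite -[LHS]fineK ?finA// munuA fineK ?finA.
Qed.

End ProductIndicators.

(** * Measures on the cone *)

Section PowerBounds.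
Context {R : realType}.

Lemma exprD_le (x y : R) m : 0 <= x -> 0 <= y ->
  (x + y) ^+ m <= 2 ^+ m * (x ^+ m + y ^+ m).
Proof.
move=> x0 y0; wlog xy : x y x0 y0 / x <= y.
  move=> H; have [xy|/ltW yx] := leP x y; first exact: H.
  by rewrite addrC [in leRHS]addrC; exact: H.
apply: (@le_trans _ _ ((2 * y) ^+ m)).
  by apply: lerXn2r; rewrite ?nnegrE ?addr_ge0 ?mulr_ge0//; lra.
by rewrite exprMn ler_wpM2l ?exprn_ge0// lerDr exprn_ge0.
Qed.

Lemma exp_sum_le n m : exists2 c : R, 0 <= c &
  forall y : 'I_n -> R, (forall i, 0 <= y i) ->
    (1 + \sum_i y i) ^+ m <= c * (1 + \sum_i y i ^+ m).
Proof.
elim: n => [|n [c c0 IHn]].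
  by exists 1 => // y _; rewrite !big_ord0 addr0 expr1n mul1r.
exists (2 ^+ m * (c + 1)) => [|y y0].
  by rewrite mulr_ge0 ?exprn_ge0 ?addr_ge0.
rewrite !big_ord_recr/= !addrA.
apply: (le_trans (exprD_le m _ (y0 ord_max))).
  by rewrite addr_ge0// sumr_ge0.
rewrite -mulrA ler_wpM2l ?exprn_ge0//.
have := IHn (fun i => y (widen_ord (leqnSn n) i)) (fun i => y0 _).
set S := \sum_(i < n) y _ ^+ m; set z := y ord_max ^+ m => le1.
have S0 : 0 <= S by apply: sumr_ge0 => i _; exact: exprn_ge0.
have z0 : 0 <= z by exact: exprn_ge0.
have : 0 <= c * z by rewrite mulr_ge0.
move: le1; set X := (1 + _) ^+ m; nra.
Qed.

End PowerBounds.

Lemma measurable_sqrtr (R : realType) :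
  measurable_fun [set: R] (fun y : R => Num.sqrt y).
Proof. by apply: continuous_measurable_fun; exact: sqrt_continuous. Qed.

Section ConeMeasures.
Context {R : realType} {n : nat}.
Variables v v' : n.-tuple 'rV[R]_n.
Hypothesis v_basis : basis_of fullv v.
Hypothesis v'_dual : forall i j : 'I_n, dotp (tnth v' i) (tnth v j) = (i == j)%:R.
Implicit Types (p : {measure set (borel_rV R n) -> \bar R}) (x : borel_rV R n).

(** Defined on the whole space, with value 0 where the coordinate is negative, so that integrals can
    run over everything; the measures considered do not charge the complement of the cone. *)
Definition root_coord (j : 'I_n) x : R := Num.sqrt (dotp (tnth v' j) x).

Let mC := measurable_pos_cone v_basis v'_dual.

Lemma root_coord_ge0 j x : 0 <= root_coord j x.
Proof. exact: sqrtr_ge0. Qed.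

Lemma root_coord_sqr j x : pos_cone v x ->
  root_coord j x ^+ 2 = dotp (tnth v' j) x.
Proof. by rewrite (pos_coneE v_basis v'_dual) => /= x0; rewrite sqr_sqrtr. Qed.

Lemma measurable_root_coord j : measurable_fun [set: borel_rV R n] (root_coord j).
Proof.
exact: (measurableT_comp (@measurable_sqrtr R) (measurable_dotp _)).
Qed.

Let sc := scale root_coord.

Let sc_ge1 x : 1 <= sc x.
Proof. by rewrite lerDl sumr_ge0// => j _; rewrite exprn_ge0// root_coord_ge0. Qed.

Let sc_ge0 x : 0 <= sc x. Proof. exact: le_trans (sc_ge1 x). Qed.

Let measurable_sc : measurable_fun [set: borel_rV R n] sc.
Proof.
apply: measurable_funD; first exact: measurable_cst.
by apply: measurable_sum => j; apply: measurable_funX; exact: measurable_root_coord.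
Qed.

Lemma measurable_enorm : measurable_fun [set: borel_rV R n] (enorm : borel_rV R n -> R).
Proof.
apply: (measurableT_comp (@measurable_sqrtr R)).
apply: measurable_sum => l; apply: measurable_funM;
  by apply: continuous_measurable_rV; exact: coord_continuous.
Qed.

Lemma integral_pos_cone p (f : borel_rV R n -> \bar R) :
  supported_in p (pos_cone v) -> measurable_fun setT f ->
  (forall x, 0 <= f x)%E -> (\int[p]_x f x = \int[p]_(x in pos_cone v) f x)%E.
Proof.
move=> pC mf f0.
rewrite (@ge0_negligible_integral _ _ _ p setT (~` pos_cone v) f)//.
  by rewrite setTD setCK.
exact: measurableC.
Qed.

Let sc_le_enorm : exists2 c, 0 <= c & forall x, sc x <= 1 + c * enorm x.
Proof.
exists (\sum_j \sum_l `|tnth v' j 0 l|) => [|x].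
  by apply: sumr_ge0 => j _; exact: sumr_ge0.
rewrite lerD2l mulr_suml; apply: ler_sum => j _.
have -> : root_coord j x ^+ 2 = Num.max 0 (dotp (tnth v' j) x).
  rewrite /root_coord; have [d0|d0] := leP 0 (dotp (tnth v' j) x).
    by rewrite sqr_sqrtr.
  by rewrite ltr0_sqrtr// expr0n.
rewrite ge_max mulr_ge0 ?sqrtr_ge0 ?sumr_ge0//=.
rewrite (le_trans (ler_norm _))// (le_trans (ler_norm_sum _ _ _))// mulr_suml.
by apply: ler_sum => l _; rewrite normrM ler_wpM2l// norm_coord_le_enorm.
Qed.

Let enorm_le_sc : exists2 c, 1 <= c & forall x, pos_cone v x -> enorm x <= c * sc x.
Proof.
exists (1 + \sum_l \sum_j `|tnth v j 0 l|) => [|x Cx].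
  by rewrite lerDl sumr_ge0// => j _; exact: sumr_ge0.
rewrite (le_trans (enorm_le_sum x))// mulrDl mul1r ler_wpDl// mulr_suml.
apply: ler_sum => l _; rewrite (le_trans (norm_coord_le_dual v_basis v'_dual x l))//.
rewrite mulr_suml; apply: ler_sum => j _.
rewrite mulrC ler_wpM2l// -(root_coord_sqr j Cx) ger0_norm ?sqr_ge0//.
rewrite /sc /scale (bigD1 j)//= addrCA lerDl addr_ge0// sumr_ge0// => i _.
by rewrite sqr_ge0.
Qed.

Lemma integrable_scale_of_finite_moments p k :
  finite_moments p -> p.-integrable [set: borel_rV R n] (fun x => (sc x ^+ k)%:E).
Proof.
move=> fm; have [c c0 scle] := sc_le_enorm.
have ei i : p.-integrable [set: borel_rV R n] (fun x => (enorm x ^+ i)%:E).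
  apply/integrableP; split.
    by apply/measurable_EFinP; apply: measurable_funX; exact: measurable_enorm.
  have := fm i%:R (ler0n _ _); apply: le_lt_trans.
  rewrite le_eqVlt; apply/orP; left; apply/eqP; apply: eq_integral => x _.
  by rewrite powR_mulrn ?sqrtr_ge0// gee0_abs// lee_fin exprn_ge0 ?sqrtr_ge0.
have i1 : p.-integrable [set: borel_rV R n]
    (fun x => (1 + c ^+ k * enorm x ^+ k)%:E).
  have i0 : p.-integrable [set: borel_rV R n] (fun x => 1%:E).
    by have := ei 0; under eq_fun do rewrite expr0.
  exact: (integrableD measurableT i0 (integrableZl measurableT (c ^+ k) (ei k))).
have i2 : p.-integrable [set: borel_rV R n]
    (fun x => (2 ^+ k * (1 + c ^+ k * enorm x ^+ k))%:E).
  exact: (integrableZl measurableT (2 ^+ k) i1).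
apply: le_integrable i2 => //.
  by apply/measurable_EFinP; exact: measurable_funX.
move=> x _ /=; have e0 : 0 <= enorm x by exact: sqrtr_ge0.
have ce0 : 0 <= c * enorm x by rewrite mulr_ge0.
rewrite lee_fin ger0_norm ?exprn_ge0// (le_trans _ (ler_norm _))//.
apply: (@le_trans _ _ ((1 + c * enorm x) ^+ k)).
  apply: lerXn2r; [exact: sc_ge0|by rewrite nnegrE addr_ge0|exact: scle].
by rewrite (le_trans (exprD_le k ler01 ce0))// expr1n exprMn.
Qed.

Lemma finite_moments_of_integrable_scale p :
  supported_in p (pos_cone v) ->
  (forall k, p.-integrable [set: borel_rV R n] (fun x => (sc x ^+ k)%:E)) ->
  finite_moments p.
Proof.
move=> pC si e e0; have [c c1 ele] := enorm_le_sc.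
have me : measurable_fun [set: borel_rV R n] (fun x => (enorm x `^ e)%:E).
  apply/measurable_EFinP; apply: (measurableT_comp (measurable_powR _)).
  exact: measurable_enorm.
rewrite integral_pos_cone//; last by move=> x; rewrite lee_fin powR_ge0.
pose k := Num.bound e; have ek : e <= k%:R by rewrite ltW// archi_boundP.
have i1 : p.-integrable [set: borel_rV R n] (fun x => (c ^+ k * sc x ^+ k)%:E).
  exact: (integrableZl measurableT (c ^+ k) (si k)).
have c0 : 0 <= c by exact: le_trans c1.
have g0 x : 0 <= c ^+ k * sc x ^+ k by rewrite mulr_ge0 ?exprn_ge0.
have mg : measurable_fun [set: borel_rV R n] (fun x => (c ^+ k * sc x ^+ k)%:E).
  by case/integrableP: i1.
apply: (@le_lt_trans _ _ (\int[p]_(x in pos_cone v) (c ^+ k * sc x ^+ k)%:E)%E).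
  apply: ge0_le_integral => //.
  - by move=> x _; rewrite lee_fin powR_ge0.
  - exact: measurable_funTS.
  - exact: measurable_funTS.
  move=> x Cx; rewrite lee_fin -exprMn.
  (* A base of at least 1 allows the real exponent [e] to be raised to the integer [k]; this is why
     [enorm_le_sc] provides [1 <= c]. *)
  have csc : 1 <= c * sc x by rewrite -[1]mulr1 ler_pM.
  rewrite -powR_mulrn ?mulr_ge0//.
  apply: (@le_trans _ _ ((c * sc x) `^ e)); last exact: ler_powR.
  by apply: ge0_ler_powR; rewrite ?nnegrE ?mulr_ge0 ?sqrtr_ge0// ele.
rewrite -integral_pos_cone//.
have /integrableP[_] := i1.
by under eq_integral do rewrite gee0_abs ?lee_fin//.
Qed.

(** The weight controls only powers of single coordinates. Mixed moments follow because a power of a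
    sum is bounded by a multiple of the sum of the powers. *)
Lemma integrable_scale_of_coord_moments p k : (p setT < +oo)%E ->
  (forall j, \int[p]_x (root_coord j x ^+ k.*2)%:E < +oo)%E ->
  p.-integrable [set: borel_rV R n] (fun x => (sc x ^+ k)%:E).
Proof.
move=> pfin mom; have [c c0 cle] := @exp_sum_le R n k.
have i1 : p.-integrable [set: borel_rV R n] (fun x => 1%:E).
  apply/integrableP; split; first exact: measurable_cst.
  by under eq_integral do rewrite abse1; rewrite integral_cst// mul1e.
have i2 j : p.-integrable [set: borel_rV R n] (fun x => ((root_coord j x ^+ 2) ^+ k)%:E).
  apply/integrableP; split.
    apply/measurable_EFinP; apply: measurable_funX; apply: measurable_funX.
    exact: measurable_root_coord.
  have := mom j; apply: le_lt_trans.
  rewrite le_eqVlt; apply/orP; left; apply/eqP; apply: eq_integral => x _.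
  by rewrite -exprM mul2n gee0_abs// lee_fin exprn_ge0 ?root_coord_ge0.
have i3 : p.-integrable [set: borel_rV R n]
    (fun x => (c * (1 + \sum_j (root_coord j x ^+ 2) ^+ k))%:E).
  under eq_fun do rewrite EFinM EFinD -sumEFin.
  apply: integrableZl => //; apply: integrableD => //.
  by apply: integrable_sum => // j _; exact: i2.
apply: le_integrable i3 => //.
  by apply/measurable_EFinP; exact: measurable_funX.
move=> x _ /=; rewrite lee_fin ger0_norm ?exprn_ge0// (le_trans _ (ler_norm _))//.
by apply: cle => j; rewrite sqr_ge0.
Qed.

(** On the cone, thresholds for x_j become thresholds for its root. A negative [a j] excludes no
    point of the cone, whereas the default [Num.sqrt (a j) = 0] would exclude the face where x_j is
    0; hence the value -1. *)
Lemma measure_upper_box_root p (a : 'I_n -> R) : supported_in p (pos_cone v) ->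
  p (upper_box v' a) =
  p [set x | forall j, (if a j < 0 then -1 else Num.sqrt (a j)) < root_coord j x].
Proof.
move=> pC; set A := upper_box _ _; set B := [set x | _].
have mA : measurable A by exact: measurable_upper_box.
have mB : measurable B.
  rewrite (_ : B = \bigcap_(j in [set: 'I_n]) (root_coord j @^-1`
      `](if a j < 0 then -1 else Num.sqrt (a j)), +oo[)).
    apply: fin_bigcap_measurable => // j _.
    by rewrite -[X in measurable X]setTI; exact: measurable_root_coord.
  apply/seteqP; split => x /=.
    by move=> Ax i _ /=; rewrite in_itv/= andbT.
  by move=> Ax i; have := Ax i I; rewrite /= in_itv/= andbT.
have pI (E : set (borel_rV R n)) : measurable E -> p E = p (E `&` pos_cone v).
  move=> mE; have ED0 : p (E `\` pos_cone v) = 0%E.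
    have pC0 : p (~` pos_cone v) = 0%E := pC.
    apply/eqP; rewrite -measure_le0 -[X in (_ <= X)%E]pC0.
    apply: le_measure; rewrite ?inE; [exact: measurableD|exact: measurableC|].
    by move=> x [].
  transitivity (p (E `\` pos_cone v) + p (E `&` pos_cone v))%E.
    exact: measureDI.
  by rewrite ED0 add0e.
rewrite pI// [RHS]pI//; congr (p _); apply/seteqP; split => x [Ex Cx]; split => // j;
  have := Ex j; have /= d0 : 0 <= dotp (tnth v' j) x by move: Cx; rewrite (pos_coneE v_basis v'_dual); exact.
- move=> ax; case: (ltP (a j) 0) => [a0|a0].
    by apply: lt_le_trans (root_coord_ge0 j x); rewrite oppr_lt0.
  by rewrite ltr_sqrt// (le_lt_trans a0 ax).
- case: (ltP (a j) 0) => [a0 _|a0]; first exact: lt_le_trans a0 d0.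
  rewrite /root_coord; have [d1|] := ltP 0 (dotp (tnth v' j) x).
    by rewrite ltr_sqrt.
  by move=> /ler0_sqrtr ->; rewrite ltNge sqrtr_ge0.
Qed.

Definition dual_monomial (k : 'I_n -> nat) : mpoly.mpoly n R :=
  \prod_i (\sum_l (tnth v' i 0 l) *: (mpoly.mpolyX R (mpoly.mnm1 l) : mpoly.mpoly n R)) ^+ k i.

Lemma poly_fun_dual_monomial k (x : 'rV[R]_n) :
  poly_fun (dual_monomial k) x = \prod_i dotp (tnth v' i) x ^+ k i.
Proof.
rewrite /poly_fun /dual_monomial rmorph_prod; apply: eq_bigr => i _.
rewrite rmorphXn; congr (_ ^+ _); rewrite raddf_sum; apply: eq_bigr => l _.
by rewrite /= mpoly.mevalZ mpoly.mevalXU.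
Qed.

Lemma integral_root_coord p k : supported_in p (pos_cone v) ->
  (\int[p]_x (\prod_i root_coord i x ^+ (k i).*2)%:E =
   \int[p]_(x in pos_cone v) (poly_fun (dual_monomial k) x)%:E)%E.
Proof.
move=> pC; rewrite integral_pos_cone//.
- apply: eq_integral => x; rewrite inE => Cx; congr EFin.
  rewrite poly_fun_dual_monomial; apply: eq_bigr => i _.
  by rewrite -mul2n exprM root_coord_sqr.
- apply/measurable_EFinP; apply: measurable_prod => i _; apply: measurable_funX.
  exact: measurable_root_coord.
- move=> x; rewrite lee_fin; apply: prodr_ge0 => i _.
  by rewrite exprn_ge0// root_coord_ge0.
Qed.

(** * Moments from the weight, and determinacy *)

Section Weight.
Variable w : 'rV[R]_n -> R.
Hypothesis w_weight : weight w.
Hypothesis w_meas : measurable_fun [set: borel_rV R n] (w : borel_rV R n -> R).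
Variable mu : {measure set (borel_rV R n) -> \bar R}.
Hypothesis mu_supp : supported_in mu (pos_cone v).
Hypothesis mu_int : (\int[mu]_(x in pos_cone v) (w (cone_sqrt v x))%:E^-1 < +oo)%E.

Let winv x : \bar R := ((w (cone_sqrt v x))%:E^-1)%E.

Let winv_ge0 x : (0 <= winv x)%E.
Proof. by rewrite inve_ge0 lee_fin; case: w_weight. Qed.

Let measurable_winv : measurable_fun [set: borel_rV R n] winv.
Proof.
have mw : measurable_fun [set: borel_rV R n] (fun x => w (cone_sqrt v x)).
  apply: (measurableT_comp w_meas); apply: continuous_measurable_rV_rV.
  exact: continuous_cone_sqrt v_basis v'_dual.
rewrite (_ : winv = fun x => if w (cone_sqrt v x) == 0 then +oo%E
    else (w (cone_sqrt v x) `^ (-1))%:E); last first.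
  apply/funext => x; rewrite /winv inver powR_inv1//; by case: w_weight.
apply: measurable_fun_ifT => //; first exact: measurable_fun_eqr.
apply/measurable_EFinP; exact: (measurableT_comp (measurable_powR _)).
Qed.

Let K : R := fine (\int[mu]_(x in pos_cone v) winv x)%E.

Let KE : (K%:E = \int[mu]_(x in pos_cone v) winv x)%E.
Proof.
rewrite fineK// ge0_fin_numE//; apply: integral_ge0 => x _; exact: winv_ge0.
Qed.

(** Pointwise [f] is at most [c] times the inverse weight. At zeros of the weight the right-hand
    side is [+oo] because [c] is strictly positive. *)
Let weighted_bound (f : borel_rV R n -> R) (c : R) :
  measurable_fun setT f -> (forall x, 0 <= f x) -> 0 < c ->
  (forall x, f x * w (cone_sqrt v x) <= c) ->
  (\int[mu]_x (f x)%:E <= (K * c)%:E)%E.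
Proof.
move=> mf f0 c0 fw.
have mf' : measurable_fun setT (fun x => (f x)%:E) by exact/measurable_EFinP.
rewrite integral_pos_cone// mulrC EFinM KE.
rewrite -ge0_integralZl//; last 2 first.
- exact: measurable_funTS.
- by rewrite lee_fin ltW.
apply: ge0_le_integral => //.
- by move=> x _; rewrite lee_fin.
- exact: measurable_funTS.
- by apply: measurable_funTS; exact: measurable_funeM.
move=> x _; rewrite /winv inver; case: eqP => [_|/eqP w0].
  by rewrite gt0_muley ?lte_fin// leey.
rewrite -EFinM lee_fin ler_pdivlMr ?fw//.
by have [w_ge0 _] := w_weight; rewrite lt_neqAle eq_sym w0 w_ge0.
Qed.

Lemma weighted_measure_finite : (mu setT < +oo)%E.
Proof.
have [_ [B0 [_ /(_ (`|B0| + 1))]]] := w_weight.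
rewrite (le_lt_trans (ler_norm _)) ?ltrDl// => /(_ isT) wB.
have B1 : 0 < `|B0| + 1 by rewrite ltr_wpDl.
have := @weighted_bound (cst 1) (`|B0| + 1) (measurable_cst _) (fun=> ler01) B1 _.
have -> : (\int[mu]_x (cst 1 x)%:E = mu setT)%E.
  by rewrite -[RHS]mul1e -(integral_cst mu measurableT 1).
move=> H; apply: le_lt_trans (H _) (ltry _) => x.
by rewrite mul1r (le_trans (ler_norm _))// wB.
Qed.

Lemma weighted_moment_le j k c : 0 < c ->
  (forall x : 'rV[R]_n, dotp (tnth v' j) x ^+ k.*2 * w x <= c ^+ 2) ->
  (\int[mu]_x (root_coord j x ^+ k.*2)%:E <= (K * c ^+ 2)%:E)%E.
Proof.
move=> c0 cw; apply: weighted_bound.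
- by apply: measurable_funX; exact: measurable_root_coord.
- by move=> x; rewrite exprn_ge0// root_coord_ge0.
- by rewrite exprn_gt0.
by move=> x; rewrite /root_coord -(dotp_cone_sqrt v_basis v'_dual).
Qed.

Hypothesis w_qa : quasi_analytic w v'.

Lemma weighted_determinate : determinate_on (pos_cone v) mu.
Proof.
have /choice[M MP] j := quasi_analytic_majorant w_weight (w_qa j).
have M0 j k : 0 < M j k by case: (MP j).
have mu_mom j k := weighted_moment_le (M0 j k) (fun x => let: And4 _ _ _ H := MP j in H k x).
have mu_sc k : mu.-integrable [set: borel_rV R n] (fun x => (sc x ^+ k)%:E).
  apply: integrable_scale_of_coord_moments; first exact: weighted_measure_finite.
  by move=> j; apply: le_lt_trans (mu_mom j k) (ltry _).
split=> //; first exact: finite_moments_of_integrable_scale.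
move=> nu nu_fm nu_supp nu_mu.
have nu_sc k := integrable_scale_of_finite_moments k nu_fm.
have mom_eq k : (\int[mu]_x (\prod_i root_coord i x ^+ (k i).*2)%:E =
    \int[nu]_x (\prod_i root_coord i x ^+ (k i).*2)%:E)%E.
  by rewrite !integral_root_coord// nu_mu.
(* The weight says nothing about [nu] directly, but on the cone [root_coord j x ^+ k.*2] is the
   polynomial x_j^k, so the bound for [mu] carries over with the same constants. *)
have nu_mom j k : (\int[nu]_x (root_coord j x ^+ k.*2)%:E <= (K * M j k ^+ 2)%:E)%E.
  pose k' i := if i == j then k else 0%N.
  have prodE x : root_coord j x ^+ k.*2 = \prod_i root_coord i x ^+ (k' i).*2.
    rewrite (bigD1 j)//= {1}/k' eqxx big1 ?mulr1// => i /negbTE ij.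
    by rewrite /k' ij.
  under eq_integral do rewrite prodE.
  rewrite -mom_eq; under eq_integral do rewrite -prodE.
  exact: mu_mom.
apply: (measure_eq_of_upper_box v_basis v'_dual weighted_measure_finite) => a.
rewrite !measure_upper_box_root//.
apply: (measure_upper_orthant_eq (M := M) (K := K)) => //.
- exact: measurable_root_coord.
- exact: root_coord_ge0.
- by move=> j; case: (MP j).
- by move=> j; case: (MP j).
by move=> k; rewrite /Rintegral mom_eq.
Qed.

End Weight.
End ConeMeasures.

Theorem theorem5p2 (R : realType) (n : nat)
  (v v' : n.-tuple 'rV[R]_n)
  (v_basis : basis_of fullv v)
  (v'_dual : forall i j : 'I_n, dotp (tnth v' i) (tnth v j) = (i == j)%:R)
  (w : 'rV[R]_n -> R)
  (w_weight : weight w)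
  (w_meas : measurable_fun [set: borel_rV R n] (w : borel_rV R n -> R))
  (w_qa : quasi_analytic w v')
  (mu : {measure set (borel_rV R n) -> \bar R})
  (mu_supp : supported_in mu (pos_cone v))
  (mu_int : (\int[mu]_(x in pos_cone v) (w (cone_sqrt v x))%:E^-1 < +oo)%E) :
  determinate_on (pos_cone v) mu.
Proof. exact: weighted_determinate w_qa. Qed.
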